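(* In the setting of the context, assuming $A_{2m-1}C_{2m+2}=C_{2m}A_{2m+3}$ for all integers $2\le m\le\lfloor M/2\rfloor-2$, the charges mutually commute: $[Q_M^{(k)},Q_M^{(l)}]=0$ for all integers $k,l\ge 0$.
   Context: Extended FFD setting. Fix an integer $M\ge 1$ and complex numbers $b_1,\dots,b_M$ and $\bar b_{2m+1}$ for $0\le m\le\lfloor M/2\rfloor$. Let $\mathcal{A}$ be a unital associative complex algebra containing elements $h_1,\dots,h_M$ and $\bar h_{1},\bar h_3,\dots,\bar h_{2\lfloor M/2\rfloor+1}$ (the ''generators''; write $h_{\overline{2m+1}}:=\bar h_{2m+1}$), with $h_j^2=b_j^2\,\mathbb{1}$ and $\bar h_{2m+1}^2=\bar b_{2m+1}^2\,\mathbb{1}$. Define the frustration graph $G_M=(V_M,E_M)$ whose vertices are the generators and whose edges are: $h_i\sim h_j$ iff $|i-j|\in\{1,2\}$; $\bar h_{2m-1}\sim h_j$ iff $j\in\{2m-7,2m-5,2m-3,2m-1,2m-2,2m\}$; $\bar h_{2m-1}\sim\bar h_{2m'-1}$ iff $|m-m'|=1$. Assume adjacent generators anticommute and distinct non-adjacent generators commute. Any symbol $h_j$ or $\bar h_j$ whose index lies outside the ranges above denotes $0$. Define $A_{2m-1}:=h_{2m}h_{2m-3}+h_{2m-2}\bar h_{2m+1}$ and $C_{2m}:=h_{2m-3}\bar h_{2m+3}$. An independent set is a set of vertices of $G_M$ no two of which are adjacent; for an independent set $S$, $h_S:=\prod_{v\in S}h_v$ (the factors commute, so the order is irrelevant),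 $h_\emptyset=\mathbb{1}$. The charges are $Q_M^{(k)}:=\sum_{S\text{ independent},\,|S|=k}h_S$ ($Q_M^{(0)}=\mathbb{1}$), and $H_M:=Q_M^{(1)}=\sum_{j=1}^M h_j+\sum_{m=0}^{\lfloor M/2\rfloor}\bar h_{2m+1}$. *)

(* Defs.v *)
From HB Require Import structures.
From mathcomp Require Import all_boot all_order all_algebra.
From mathcomp Require Import complex.
From mathcomp Require Import Rstruct.
Set Implicit Arguments. Unset Strict Implicit. Unset Printing Implicit Defensive.
Import Order.TTheory GRing.Theory Num.Theory.
Local Open Scope ring_scope.

Definition Cplx : Type := complex Rdefinitions.R.
Notation "''CC'" := Cplx.

(* Vertices of G_M: inl i stands for h_(i+1) (1 <= i+1 <= M),
   inr m stands for \bar h_(2m+1) (0 <= m <= M/2). *)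
Definition vert (M : nat) : finType := ('I_M + 'I_(M./2).+1)%type.

Definition vlab (M : nat) (v : vert M) : nat :=
  match v with inl i => (val i).+1 | inr m => (val m).*2.+1 end.

Definition dist12 (i j : nat) : bool :=
  [|| i == j.+1, j == i.+1, i == j.+2 | j == i.+2].

Definition bar_h_adj (b j : nat) : bool :=
  [|| j + 6 == b, j + 4 == b, j + 2 == b, j == b, j + 1 == b | j == b + 1].

Definition adj (M : nat) (u v : vert M) : bool :=
  match u, v with
  | inl i, inl j => dist12 (val i).+1 (val j).+1
  | inr m, inl j => bar_h_adj (val m).*2.+1 (val j).+1
  | inl j, inr m => bar_h_adj (val m).*2.+1 (val j).+1
  | inr m, inr m' => ((val m).+1 == (val m').+2) || ((val m').+1 == (val m).+2)
  end.

Definition independent (M : nat) (S : {set vert M}) : bool :=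
  [forall u in S, forall v in S, ~~ adj u v].

Section Gen.
Variables (A : algType 'CC) (M : nat) (h hb : nat -> A).

Definition gen (v : vert M) : A :=
  match v with inl i => h (val i).+1 | inr m => hb (val m).*2.+1 end.

Definition hS (S : {set vert M}) : A := \prod_(v in S) gen v.

Definition charge (k : nat) : A :=
  \sum_(S : {set vert M} | independent S && (#|S| == k)) hS S.

Definition hz (j : nat) : A := if (1 <= j <= M)%N then h j else 0.
Definition hbz (j : nat) : A :=
  if odd j && (j <= (M./2).*2.+1)%N then hb j else 0.

(* A_{2m-1} and C_{2m}, as functions of m (indices below 0 are truncated
   to 0 by nat subtraction, which is out of range and hence gives 0, as it should) *)
Definition Aop (m : nat) : A :=
  hz (2 * m) * hz (2 * m - 3) + hz (2 * m - 2) * hbz (2 * m + 1).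
Definition Cop (m : nat) : A := hz (2 * m - 3) * hbz (2 * m + 3).
End Gen.

(* Main.v *)
Require Import Defs.
From HB Require Import structures.
From mathcomp Require Import all_boot all_order all_algebra.
From mathcomp Require Import complex.
From mathcomp Require Import Rstruct.
From mathcomp Require Import zify.
Import Order.TTheory GRing.Theory Num.Theory.

(** A product of two charges is a sum over pairs (S, S') of independent sets,
and only pairs with an odd number of edges between S and S' contribute to the
commutator.  Let D be the symmetric difference of S and S'.  If a connected
component of D with an odd number of edges meets S and S' in equally many
vertices, exchanging S and S' on it preserves the cardinalities and reverses
the sign of the product, so the contributions cancel in pairs.

A component can only be unbalanced because of an induced claw.  With
A_m := A_{2m-1} and C_m := C_{2m}, iterating the hypothesis gives, for n = m+2r,
  A_m C_{m+1} C_{m+3} ... C_{n+1} = C_m C_{m+2} ... C_n A_{n+2}.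
The four monomials in this identity are the products over four trees, each
contained in a pair (S, S') with its centres on one side and its leaves on the
other.  If S and S' contain no other vertex near such a tree, it can be replaced
by any of the three others, and the four products add up to zero; these
replacements do not interact for different (m, n), so the pairs containing such
an isolated tree contribute zero.  In the absence of isolated trees, every vertex
of degree 3 in D is compensated by a vertex of degree at most 1 on the same side
of the same component, which is therefore balanced. *)

Set Implicit Arguments. Unset Strict Implicit. Unset Printing Implicit Defensive.

(** * Products over stable sets of a signed commuting family *)

Section SignedFamily.
Local Open Scope ring_scope.
Variables (R : nzRingType) (T : finType) (e : rel T) (g : T -> R).
Hypothesis gC : forall u v, g u * g v = (-1) ^+ e u v * (g v * g u).

Definition stable (S : {set T}) := [forall u in S, forall v in S, ~~ e u v].

Definition mon (S : {set T}) : R := \prod_(v in S) g v.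

Definition edges (X Y : {set T}) : nat := (\sum_(u in X) \sum_(v in Y) e u v)%N.

Lemma stableP (S : {set T}) :
  reflect {in S &, forall u v, ~~ e u v} (stable S).
Proof.
apply: (iffP forall_inP) => H u; last by move=> Hu; apply/forall_inP => v; apply: H.
by move=> v /H /forall_inP; apply.
Qed.

Lemma prod_signC (u : T) (r : seq T) (P : pred T) :
  g u * (\prod_(v <- r | P v) g v) =
  (-1) ^+ (\sum_(v <- r | P v) e u v)%N * ((\prod_(v <- r | P v) g v) * g u).
Proof.
elim: r => [|v r IH]; first by rewrite !big_nil mulr1 !mul1r.
rewrite !big_cons; case: (P v) => //.
rewrite mulrA gC exprD -!mulrA; congr (_ * _).
by rewrite IH !mulrA (commr_sign (g v)).
Qed.

Lemma monC (X Y : {set T}) :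
  mon X * mon Y = (-1) ^+ edges X Y * (mon Y * mon X).
Proof.
pose d u := (\sum_(v in Y) e u v)%N.
rewrite {1 4}/mon (_ : edges X Y = \sum_(u in X) d u)%N //.
have dP u : g u * mon Y = (-1) ^+ d u * (mon Y * g u) by apply: prod_signC.
elim: (index_enum T) => [|u r IH]; first by rewrite !big_nil mulr1 !mul1r.
rewrite !big_cons; case: (u \in X) => //.
set P := (\prod_(j <- r | j \in X) g j) in IH *.
set s := (\sum_(j <- r | j \in X) d j)%N in IH *.
transitivity (g u * ((-1) ^+ s * (mon Y * P))); first by rewrite -IH mulrA.
rewrite [LHS]mulrA (commr_sign (g u)) -mulrA [g u * (mon Y * P)]mulrA dP.
by rewrite -!mulrA mulrA -exprD addnC.
Qed.

Lemma mon1 v : mon [set v] = g v. Proof. by rewrite /mon big_set1. Qed.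

(** Both sides multiply the same generators in different orders; stability of the union makes every
    sign trivial. *)
Lemma mon_setU (X Y : {set T}) :
  stable (X :|: Y) -> [disjoint X & Y] -> mon (X :|: Y) = mon X * mon Y.
Proof.
move=> /stableP st dXY; rewrite /mon.
elim: (index_enum T) => [|u r IH]; first by rewrite !big_nil mulr1.
rewrite !big_cons inE; have [uX|uX] /= := boolP (u \in X).
  by rewrite (disjointFr dXY uX) IH mulrA.
case: ifP => uY //.
rewrite IH mulrA (mulrA _ (g u)); congr (_ * _).
rewrite prod_signC big1 ?mul1r // => v vX.
by rewrite (negPf (st _ _ _ _)) // inE ?uY ?vX ?orbT.
Qed.

End SignedFamily.

(** * Columns: labels of the vertices and the claw chains *)

(** The label [(a, k)], [k] being called the column, stands for [h_(2k-1)] if [a = KO],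
    for [h_(2k)] if [a = KE] and for [\bar h_(2k+1)] if [a = KB]. *)
Definition label : eqType := (option bool * nat)%type.
Notation KO := (Some true) (only parsing).
Notation KE := None (only parsing).
Notation KB := (Some false) (only parsing).

(** The last branch treats labels of equal kind. The widest reach is that between [KO] and [KB],
    over four consecutive columns; [adj_label] checks the agreement with the frustration graph. *)
Definition ladj (x y : label) : bool :=
  let: (a, i) := x in let: (b, j) := y in
  match a, b with
  | KO, KB => (i <= j.+1) && (j <= i.+2)
  | KB, KO => (j <= i.+1) && (i <= j.+2)
  | KE, KO => (j == i) || (j == i.+1)
  | KO, KE => (i == j) || (i == j.+1)
  | KE, KB => (i == j) || (i == j.+1)
  | KB, KE => (j == i) || (j == i.+1)
  | _, _ => (i == j.+1) || (j == i.+1)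
  end.

(** For [1 < m], [m <= n], [n - m] even and [n + 2 <= M./2], the four trees
    are indexed by [t] and [s]: [t] selects [A_m C_(m+1) ... C_(n+1)] or
    [C_m ... C_n A_(n+2)], and [s] the monomial of [A_m] or [A_(n+2)].  The centres are the
    [O_m, O_(m+2), ..., O_n] for [t = true] and the [B_(m+1), B_(m+3), ..., B_(n+1)] for
    [t = false]; the leaves are the other vertices. *)
Definition centre (t : bool) (m n : nat) (x : label) : bool :=
  let: (a, k) := x in
  match t, a with
  | true, KO => [&& m <= k, k <= n & ~~ odd (k + m)]
  | false, KB => [&& m < k, k <= n.+1 & odd (k + m)]
  | _, _ => false
  end.

Definition leaf (t s : bool) (m n : nat) (x : label) : bool :=
  let: (a, k) := x in
  match t, a with
  | true, KO => s && (k.+1 == m)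
  | true, KE => if s then k == m else k.+1 == m
  | true, KB => [&& m.+2 <= k, k <= n.+2 & ~~ odd (k + m)] || ~~ s && (k == m)
  | false, KO => [&& m <= k.+1, k < n & odd (k + m)] || s && (k == n.+1)
  | false, KE => if s then k == n.+2 else k == n.+1
  | false, KB => ~~ s && (k == n.+2)
  end.

(** The reflection exchanging [h_odd] and [\bar h] is a symmetry of the graph, so
    that only claws centred at an [h_odd] have to be studied. *)
Definition flip (c : nat) (x : label) : label := (omap negb x.1, c - x.2).

Lemma ladjC x y : ladj x y = ladj y x.
Proof. by case: x y => -[[]|] i [] -[[]|] j //=; lia. Qed.

Lemma ladjxx x : ladj x x = false.
Proof. by case: x => -[[]|] i /=; lia. Qed.

Lemma ladj_flip c x y : x.2 <= c -> y.2 <= c ->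
  ladj (flip c x) (flip c y) = ladj x y.
Proof. by case: x y => -[[]|] i [] -[[]|] j /= *; lia. Qed.

Lemma flipK c x : x.2 <= c -> flip c (flip c x) = x.
Proof. by case: x => -[[]|] i /= H; rewrite /flip /= subKn. Qed.

(** For both values of [t] together the centres occupy the columns [m] to [n+1]. The reflection maps
    this interval to that of the parameters [c-n-1] and [c-m-1], and exchanging the kinds turns [t]
    into its negation. *)
Lemma centre_flip c t m n x : x.2 <= c -> m <= n -> n < c -> ~~ odd (m + n) ->
  centre t (c - n.+1) (c - m.+1) (flip c x) = centre (~~ t) m n x.
Proof. by case: t; case: x => -[[]|] k //= *; lia. Qed.

Lemma leaf_flip c t s m n x : x.2 <= c -> m <= n -> n.+2 <= c -> ~~ odd (m + n) -> 0 < m ->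
  leaf t s (c - n.+1) (c - m.+1) (flip c x) = leaf (~~ t) (~~ s) m n x.
Proof. by case: t; case: s; case: x => -[[]|] k //= *; lia. Qed.

(** * Isolated trees in the same pair are far apart *)

Section Separation.
Variable N : nat.
Definition valid m n := [&& 1 < m, m <= n, ~~ odd (m + n) & n.+2 <= N].

Lemma leaf_width t s m n x : 0 < m -> m <= n -> leaf t s m n x -> (m <= x.2.+1) && (x.2 <= n.+2).
Proof. by case: t; case: s; case: x => -[[]|] k //= *; lia. Qed.

Lemma centre_width t m n x : centre t m n x -> (m <= x.2) && (x.2 <= n.+1).
Proof. by case: t; case: x => -[[]|] k //= *; lia. Qed.

(** The columns that can contain a neighbour of a centre ([d = 1]) or of a leaf ([d = 2]),
    whichever of the four trees is considered. *)
Definition win (d m n k : nat) := (m <= k + d) && (k <= n + d.+1).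

Lemma leaf_out t s m n a k : 0 < m -> m <= n -> (k.+1 < m) || (n.+2 < k) ->
  leaf t s m n (a, k) = false.
Proof. by move=> m0 mn H; apply/negP => /(leaf_width m0 mn) /=; lia. Qed.

Lemma centre_out t m n a k : (k < m) || (n.+1 < k) -> centre t m n (a, k) = false.
Proof. by move=> H; apply/negP => /centre_width /=; lia. Qed.

Lemma leaf_end t s m n : 0 < m -> m <= n -> ~~ odd (m + n) ->
  exists a, leaf t s m n (a, n.+2).
Proof.
move=> m0 mn od; case: t; first by exists KB => /=; lia.
by case: s; [exists KE | exists KB] => /=; lia.
Qed.

Lemma leaf_start t s m n : 0 < m -> m <= n -> ~~ odd (m + n) ->
  exists2 a, a != KB & leaf t s m n (a, m.-1).
Proof.
move=> m0 mn od; case: t; last by exists KO => //=; lia.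
by case: s; [exists KO | exists KE] => //=; lia.
Qed.

(** Two trees that agree on their common windows cannot overlap: the right one has no leaf in column
    [m-2] and neither a [KB] leaf nor a [KB] centre in column [m-1], while a tree that starts
    earlier and reaches that far has one of them. The bound is the one for which the leaves of each
    tree avoid the leaf window of the other. *)
Lemma same_side_sep t s m n t' s' m' n' : valid m n -> valid m' n' ->
  (forall a k, 0 < k -> k <= N -> win 1 m n k -> win 1 m' n' k ->
     centre t m n (a, k) = centre t' m' n' (a, k)) ->
  (forall a k, 0 < k -> k <= N -> win 2 m n k -> win 2 m' n' k ->
     leaf t s m n (a, k) = leaf t' s' m' n' (a, k)) ->
  m' < m -> n' + 5 <= m.
Proof.
rewrite /valid /win => V V' HC HL Hlt; rewrite leqNgt; apply/negP => Hov.
have L1 a : leaf t' s' m' n' (a, m - 2) = false.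
  by rewrite -HL ?leaf_out //; lia.
have [Em|Em] := eqVneq m (n' + 4).
  have [] := @leaf_end t' s' m' n'; try lia.
  by move=> a; rewrite (_ : n'.+2 = m - 2) ?L1 //; lia.
have L2 : leaf t s m n (KB, m - 1) = leaf t' s' m' n' (KB, m - 1).
  by apply: HL; lia.
have C2 : centre t' m' n' (KB, m - 1) = false.
  by rewrite -HC ?centre_out //; lia.
have {}L2 : leaf t' s' m' n' (KB, m - 1) = false.
  by rewrite -L2; case: (t); case: (s) => /=; lia.
move: (L1 KO) (L1 KE) (L1 KB) L2 C2; clear - V V' Hlt Hov Em.
by case: t'; case: s' => /=; lia.
Qed.

(** A longer tree continues past the end of the shorter one, with a centre [KO] in column [n'+2] or
    a leaf [KO] or [KE] in column [n'+3], where the shorter one has nothing. *)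
Lemma same_start t s m n t' s' n' : valid m n -> valid m n' ->
  (forall a k, 0 < k -> k <= N -> win 1 m n k -> win 1 m n' k ->
     centre t m n (a, k) = centre t' m n' (a, k)) ->
  (forall a k, 0 < k -> k <= N -> win 2 m n k -> win 2 m n' k ->
     leaf t s m n (a, k) = leaf t' s' m n' (a, k)) ->
  n' <= n -> n' = n.
Proof.
rewrite /valid /win => V V' HC HL; rewrite leq_eqVlt => /orP[/eqP //|Hlt].
have L1 : leaf t s m n (KE, n' + 3) = false.
  by rewrite HL ?leaf_out //; lia.
have L3 : leaf t s m n (KO, n' + 3) = false.
  by rewrite HL ?leaf_out //; lia.
have C2 : centre t m n (KO, n' + 2) = false.
  by rewrite HC ?centre_out //; lia.
move: L1 L3 C2; clear - V V' Hlt.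
by case: t; case: s => /=; lia.
Qed.

(** The first tree has no centre in column [m-1], so an overlapping second tree has no leaf there.
    But the first has a leaf there which is not a [KB]; it would be a [KO] centre of the second
    tree, and such a centre always has a [KE] or [KB] leaf in its own column. *)
Lemma opposite_sep t s m n t' s' m' n' : valid m n -> valid m' n' ->
  (forall a k, 0 < k -> k <= N -> win 1 m n k -> win 2 m' n' k ->
     centre t m n (a, k) = leaf t' s' m' n' (a, k)) ->
  (forall a k, 0 < k -> k <= N -> win 2 m n k -> win 1 m' n' k ->
     leaf t s m n (a, k) = centre t' m' n' (a, k)) ->
  m' <= m -> n' + 4 <= m.
Proof.
rewrite /valid /win => V V' HC HL Hlt; rewrite leqNgt; apply/negP => Hov.
have C2 a : leaf t' s' m' n' (a, m.-1) = false.
  by rewrite -HC ?centre_out //; lia.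
have [||| a aB] := @leaf_start t s m n; try lia.
rewrite HL; try lia.
move: (C2 KE) (C2 KB) aB; clear - V V' Hlt Hov.
by case: t'; case: s'; case: a => [[]|] //=; lia.
Qed.

End Separation.

(** * Right ends of paths *)

(** The vertices of [S] that can touch the right end of a path ending in column [n] without being
    one of its centres. *)
Definition run_exits n : seq label := [:: (KE, n.+1); (KE, n.+2); (KO, n.+2)].

Section RightClaw.
Variables (N : nat) (p q : label -> bool).
Hypothesis pP : forall x y, p x -> p y -> ladj x y = false.
Hypothesis qP : forall x y, q x -> q y -> ladj x y = false.
Hypothesis qO : q (KO, 0) = false.
Hypothesis qE : q (KE, 0) = false.
Hypothesis qB : forall k, q (KB, k) -> k <= N.

(** [p] and [q] are the sets of labels of [S] and [S'].  A claw with centre [h_odd] in [S]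
    is followed to the right along the path [h_odd - \bar h - h_odd - ...] which starts at
    its leaf [KB, m + 2]: either the path ends there and the tree is isolated, or it stops
    at a vertex of [S] with no other neighbour. *)
Definition right_claw (s : bool) (m : nat) :=
  [&& p (KO, m), q (KB, m.+2) & if s then q (KE, m) && q (KO, m.-1)
                               else q (KE, m.-1) && q (KB, m)].

Definition run (m n : nat) := [/\ m <= n, ~~ odd (m + n) &
  forall k, m <= k -> k <= n -> ~~ odd (k + m) -> p (KO, k) && q (KB, k.+2)].

Lemma right_claw_gt1 s m : right_claw s m -> 1 < m.
Proof.
case/and3P=> _ _; case: m => [|[|m]] //; case: s; rewrite /= ?qO ?qE ?andbF //.
Qed.

(** Any other vertex of [S] or [S'] in the windows would be adjacent to a vertex of the tree in the
    same stable set, or be one of the three excluded exits. *)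
Lemma run_full s m n : right_claw s m -> run m n ->
  p (KE, n.+1) = false -> p (KE, n.+2) = false -> p (KO, n.+2) = false ->
  (forall x, win 1 m n x.2 -> p x = centre true m n x) /\
  (forall x, win 2 m n x.2 -> q x = leaf true s m n x).
Proof.
move=> cl [mn od rn] pE1 pE2 pO2; have m1 := right_claw_gt1 cl.
have pO k : m <= k -> k <= n -> ~~ odd (k + m) -> p (KO, k).
  by move=> k1 k2 k3; case/andP: (rn k k1 k2 k3).
have qBk k : m <= k -> k <= n -> ~~ odd (k + m) -> q (KB, k.+2).
  by move=> k1 k2 k3; case/andP: (rn k k1 k2 k3).
(* The column of the last [h_odd] of the path at or before column [k], clipped to the interval from
   [m] to [n]. Stability is tested against the path vertices nearest to [k]. *)
pose f k := minn n (m + (k - m)./2.*2).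
have [f1 f2 f3] : [/\ forall k, m <= f k, forall k, f k <= n &
                     forall k, ~~ odd (f k + m)] by split=> k; rewrite /f; lia.
split=> -[a k]; rewrite /win /= => W; apply/idP/idP.
- move=> px.
  have := pP px (pO (f k) (f1 _) (f2 _) (f3 _)).
  have := pP px (pO (f k.+1) (f1 _) (f2 _) (f3 _)).
  have E1 : (a, k) != (KE, n.+1) by apply: contraFneq pE1 => <-.
  have E2 : (a, k) != (KE, n.+2) by apply: contraFneq pE2 => <-.
  have O2 : (a, k) != (KO, n.+2) by apply: contraFneq pO2 => <-.
  move: E1 E2 O2; rewrite !xpair_eqE; clear - mn od W m1.
  by rewrite /f; case: a => [[]|] /=; lia.
- by case: a => [[]|] // /and3P[k1 k2 k3]; apply: pO.
- move=> qx; have := qP qx (qBk (f k.-2) (f1 _) (f2 _) (f3 _)).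
  case/and3P: cl => _ _.
  case: s => /andP[/(qP qx) + /(qP qx)]; clear - mn od W m1.
    by rewrite /f; case: a => [[]|] /=; lia.
  by rewrite /f; case: a => [[]|] /=; lia.
case/and3P: cl => _ _; case: s => /andP[q1 q2]; case: a => [[]|] //=.
- by move=> /eqP mk; move: q2; rewrite -mk.
- by rewrite orbF => /and3P[k1 k2 k3]; case: k k1 k2 k3 {W} => [|[|k]] // k1 k2 k3;
    apply: qBk => //; clear - k1 k2 k3; lia.
- by move=> /eqP ->.
- by case/orP=> [/and3P[]|/eqP -> //];
    case: k {W} => [|[|k]] // k1 k2 k3;
    apply: qBk => //; clear - k1 k2 k3; lia.
- by move=> /eqP mk; move: q1; rewrite -mk.
Qed.

Lemma run_lower s m n : right_claw s m -> run m n -> q (KE, n) || q (KB, n).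
Proof.
move=> cl [mn od rn]; have [E|ne] := eqVneq m n.
  by case/and3P: cl => _ _; rewrite E; case: (s) => /andP[q1 q2]; rewrite ?q1 ?q2 ?orbT.
have /andP[_] := rn n.-2 ltac:(lia) ltac:(lia) ltac:(lia).
by rewrite (_ : n.-2.+2 = n); [move=> ->; rewrite orbT | lia].
Qed.

(** The vertices of [S'] already known near the end of the path exclude all other neighbours by
    stability. Only [(KO, n.+2)] could also see [(KB, n + 4)], and in that case the path would
    continue. *)
Lemma dead_end_nbr n x y : q (KB, n.+2) -> q (KE, n) || q (KB, n) ->
  (x = (KO, n.+2) -> q (KB, n + 4) = false) ->
  x \in run_exits n -> q y -> ladj x y ->
  y \in if x == (KE, n.+1) then [:: (KE, n); (KB, n)] else [:: (KB, n.+2)].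
Proof.
move=> q2 qn q4 xin qy; have := qP q2 qy.
have : (x == (KO, n.+2)) ==> (y != (KB, n + 4)).
  by apply/implyP => /eqP /q4 q4'; apply: contraTneq qy => ->; rewrite q4'.
have : y != (KE, n.+1).
  apply: contraTneq qn => Ey; rewrite Ey in qy.
  apply/norP; split; apply/negP => /(qP qy) /=; lia.
clear - xin; have [->|] := eqVneq x (KE, n.+1).
  by rewrite !inE; case: y => -[[]|] j; rewrite ?xpair_eqE /=; lia.
move: xin; rewrite !inE => /or3P[] /eqP-> //=;
by case: y => -[[]|] j; rewrite ?xpair_eqE /=; lia.
Qed.

Lemma dead_end n x y z : q (KB, n.+2) -> q (KE, n) || q (KB, n) ->
  (x = (KO, n.+2) -> q (KB, n + 4) = false) ->
  x \in run_exits n ->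
  q y -> ladj x y -> q z -> ladj x z -> y = z.
Proof.
move=> q2 qn q4 xin qy xy qz xz; have := qP qy qz.
have := dead_end_nbr q2 qn q4 xin qz xz; have := dead_end_nbr q2 qn q4 xin qy xy.
case: ifP => _; rewrite !inE; last by move=> /eqP-> /eqP->.
by case/orP=> /eqP-> /orP[] /eqP-> //=; rewrite eqxx.
Qed.

Lemma run_prefix m n k : run m n -> m <= k -> k <= n -> ~~ odd (m + k) -> run m k.
Proof.
by move=> [mn od rn] mk kn od'; split=> // j *; apply: rn => //; apply: leq_trans kn.
Qed.

(** If [m < m'], the first path puts [(KB, m')] in [S'], which excludes the pair of leaves with
    [(KE, m')]. The other pair contains [(KE, m'-1)], which is adjacent to the vertex that
    [run_lower] provides in column [m'-2]. *)
Lemma run_start_leq s m s' m' n : right_claw s m -> run m n ->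
  right_claw s' m' -> run m' n -> m' <= m.
Proof.
move=> cl rn cl' rn'; rewrite leqNgt; apply/negP => lt.
have [mn od _] := rn; have [mn' od' _] := rn'.
have rn2 : run m m'.-2 by apply: run_prefix rn _ _ _; lia.
have qB' : q (KB, m').
  have [_ _ /(_ m'.-2)] := rn2; rewrite (_ : m'.-2.+2 = m'); last by lia.
  by move=> /(_ ltac:(lia) (leqnn _) ltac:(lia)) /andP[].
have := run_lower cl rn2.
case/and3P: cl' => _ _; case: s' => /andP[q1 q2].
  by have := qP qB' q1; rewrite /= eqxx.
by case/orP=> /(qP q1) /=; lia.
Qed.

Lemma run_end_unique s m n s' m' n' x : right_claw s m -> run m n ->
  right_claw s' m' -> run m' n' -> x \in run_exits n -> x \in run_exits n' -> m = m'.
Proof.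
move=> cl rn cl' rn' xn xn'.
have last k l : run k l -> p (KO, l).
  by move=> [kl od /(_ l kl (leqnn _))]; rewrite addnC => /(_ od) /andP[].
have En : n = n'.
  (* A common exit allows [n] and [n'] to differ only by one, and then the last centres of the two
     paths would be adjacent in [S]. *)
  have := pP (last _ _ rn) (last _ _ rn'); move: xn xn'.
  by clear; rewrite !inE; case: x => -[[]|] k; rewrite !xpair_eqE /=; lia.
rewrite En in rn; apply/eqP.
by rewrite eqn_leq (run_start_leq cl rn cl' rn') (run_start_leq cl' rn' cl rn).
Qed.

(** Here [c] is a set closed under adjacency in the union of [S] and [S'], so it contains the whole
    path. Each extension advances two columns, and [qB] bounds the columns by [N]. *)
Lemma run_exit s m (c : label -> bool) :
  (forall x y, c x -> p y || q y -> ladj x y -> c y) ->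
  (forall n, valid N m n -> ~ ((forall x, win 1 m n x.2 -> p x = centre true m n x) /\
                               (forall x, win 2 m n x.2 -> q x = leaf true s m n x))) ->
  right_claw s m -> c (KO, m) ->
  exists n x, [/\ run m n, x \in run_exits n, p x, c x &
                  x = (KO, n.+2) -> q (KB, n + 4) = false].
Proof.
move=> cP noex cl cm.
have rn0 : run m m.
  split=> //; first by rewrite addnn odd_double.
  move=> k k1 k2 _; have -> : k = m by apply/eqP; rewrite eqn_leq k1 k2.
  by case/and3P: cl => -> ->.
suff H d n : run m n -> c (KO, n) -> N - n < d ->
    exists n x, [/\ run m n, x \in run_exits n, p x, c x &
                  x = (KO, n.+2) -> q (KB, n + 4) = false] by apply: (H (N - m).+1 m).
elim: d n => // d IH n rn cn dn.
have [mn od rnP] := rn.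
have /andP[pn qn] := rnP n mn (leqnn _) ltac:(by rewrite addnC).
have cB : c (KB, n.+2) by apply: cP cn _ _; rewrite ?qn ?orbT //= leqnn ltnW // ltnW.
have nN := qB qn.
case pE2: (p (KE, n.+2)).
  exists n, (KE, n.+2); split=> //; rewrite ?inE ?eqxx ?orbT //.
  by apply: cP cB _ _; rewrite ?pE2 //= eqxx.
case pE1: (p (KE, n.+1)).
  exists n, (KE, n.+1); split=> //; rewrite ?inE ?eqxx //.
  have /orP[qE'|qB'] := run_lower cl rn.
    have cE : c (KE, n) by apply: cP cn _ _; rewrite ?qE' ?orbT //= eqxx.
    by apply: cP cE _ _; rewrite ?pE1 //= eqxx orbT.
  have cB' : c (KB, n) by apply: cP cn _ _; rewrite ?qB' ?orbT //= leqnSn ltnW.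
  by apply: cP cB' _ _; rewrite ?pE1 //= eqxx orbT.
(* With no exit present the tree would be isolated, by [run_full]. With [(KO, n.+2)] present, the
   path either goes on through [(KB, n + 4)] or stops at this exit. *)
case pO2: (p (KO, n.+2)); last first.
  case: (noex n); first by rewrite /valid (right_claw_gt1 cl) mn od nN.
  exact: run_full cl rn pE1 pE2 pO2.
have cO : c (KO, n.+2) by apply: cP cB _ _; rewrite ?pO2 //= leqnSn ltnW.
case q4: (q (KB, n + 4)).
  have dn2 : N - n.+2 < d by clear - dn nN; lia.
  apply: (IH n.+2) => //; split; first by apply: leq_trans mn _; rewrite ltnW.
    by rewrite !addnS /= negbK.
  move=> k k1 k2 k3.
  have [->|kn] := eqVneq k n.+2; first by rewrite pO2 -addn2 -addn2 -addnA q4.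
  by apply: rnP => //; clear - kn k2 k3 od mn; lia.
by exists n, (KO, n.+2); split; rewrite ?inE ?eqxx ?orbT.
Qed.

End RightClaw.

(** * Degrees in the symmetric difference *)

(** Columns 1 to [N] are complete; column 0 can only hold a [KB] and column [N+1] only a [KO]. This
    range is stable under [flip N.+1]. *)
Definition in_range (N : nat) (x : label) : bool :=
  let: (a, k) := x in
  match a with
  | KO => 0 < k <= N.+1
  | KE => 0 < k <= N
  | KB => k <= N
  end.

Lemma in_range_le N x : in_range N x -> x.2 <= N.+1.
Proof. by case: x => -[[]|] k /=; lia. Qed.

Lemma in_range_flip N x : in_range N x -> in_range N (flip N.+1 x).
Proof. by case: x => -[[]|] k /=; lia. Qed.

Section LabelledGraph.
Variables (T : finType) (lab : T -> label) (N : nat).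
Hypothesis lab_inj : injective lab.
Hypothesis lab_range : forall v, in_range N (lab v).

Definition lrel : rel T := fun u v => ladj (lab u) (lab v).

Definition nbrs (v : T) (S : {set T}) := [set u in S | lrel v u].

Definition has_label (S : {set T}) (x : label) := [exists v in S, lab v == x].

(** An isolated tree: inside the windows [C] and [L] contain its centres and leaves and nothing
    else. *)
Definition claw_at (t s : bool) (m n : nat) (C L : {set T}) : bool :=
  [forall v, win 1 m n (lab v).2 ==> ((v \in C) == centre t m n (lab v))] &&
  [forall v, win 2 m n (lab v).2 ==> ((v \in L) == leaf t s m n (lab v))].

Lemma claw_atP t s m n (C L : {set T}) :
  reflect ((forall v, win 1 m n (lab v).2 -> (v \in C) = centre t m n (lab v)) /\
           (forall v, win 2 m n (lab v).2 -> (v \in L) = leaf t s m n (lab v)))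
          (claw_at t s m n C L).
Proof.
apply: (iffP andP) => -[H1 H2]; split.
- by move=> v; move/forallP/(_ v)/implyP: H1 => H1 /H1 /eqP.
- by move=> v; move/forallP/(_ v)/implyP: H2 => H2 /H2 /eqP.
- by apply/forallP => v; apply/implyP => /H1 ->.
- by apply/forallP => v; apply/implyP => /H2 ->.
Qed.

Lemma has_labelP (S : {set T}) x : reflect (exists2 v, v \in S & lab v = x) (has_label S x).
Proof.
apply: (iffP exists_inP) => -[v vS]; first by move/eqP; exists v.
by move=> <-; exists v.
Qed.

Lemma has_label_lab (S : {set T}) v : has_label S (lab v) = (v \in S).
Proof.
apply/has_labelP/idP; first by case=> u uS /lab_inj <-.
by exists v.
Qed.

Lemma stable_label S x y : stable lrel S -> has_label S x -> has_label S y ->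
  ladj x y = false.
Proof.
by move=> /stableP st /has_labelP[u uS <-] /has_labelP[v vS <-]; apply/negbTE/st.
Qed.

Lemma clique_card S (r : seq label) : stable lrel S ->
  {in r &, forall x y, x != y -> ladj x y} ->
  #|[set u in S | lab u \in r]| <= 1.
Proof.
move=> /stableP st cl; apply/card_le1_eqP => u v; rewrite !inE => /andP[uS ur] /andP[vS vr].
apply: lab_inj; apply/eqP; apply: contraTT (st _ _ uS vS) => ne.
by rewrite negbK; apply: (cl _ _ ur vr); rewrite eq_sym.
Qed.

Section Degrees.
Variable S : {set T}.
Hypothesis Sst : stable lrel S.

(* The neighbourhood of a vertex is covered by two or three cliques. *)
Lemma nbrs_KE v k : lab v = (KE, k) -> #|nbrs v S| <= 2.
Proof.
move=> lv; set Q := fun r => [set u in S | lab u \in (r : seq label)].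
have sub : nbrs v S \subset Q [:: (KE, k.-1); (KO, k); (KB, k.-1)] :|:
                            Q [:: (KE, k.+1); (KO, k.+1); (KB, k)].
  have := lab_range v; rewrite lv => /= rg.
  apply/subsetP => u; rewrite !inE /lrel lv; case: (u \in S) => //=.
  by case: (lab u) => -[[]|] j; rewrite ?xpair_eqE /=; clear - rg; lia.
apply: leq_trans (subset_leq_card sub) _; apply: leq_trans (leq_card_setU _ _) _.
have k0 := lab_range v; rewrite lv /= in k0.
apply: (@leq_add _ _ 1 1); apply: clique_card => // x y; rewrite !inE => /or3P[] /eqP-> /or3P[] /eqP-> //=;
rewrite ?eqxx //; clear - k0; lia.
Qed.

Lemma nbrs_KO v k : lab v = (KO, k) ->
  #|nbrs v S| <= 3 /\
  (#|nbrs v S| = 3 -> has_label S (KB, k.+2) /\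
     (has_label S (KE, k) && has_label S (KO, k.-1) \/
      has_label S (KE, k.-1) && has_label S (KB, k))).
Proof.
move=> lv; have := lab_range v; rewrite lv /= => k0.
pose Q := fun r => [set u in S | lab u \in (r : seq label)].
pose r1 : seq label := [:: (KO, k.-1); (KE, k.-1); (KB, k.-1)].
pose r2 : seq label := [:: (KO, k.+1); (KE, k); (KB, k)].
pose r3 : seq label := [:: (KB, k.+1); (KB, k.+2)].
have sub : nbrs v S \subset Q r1 :|: Q r2 :|: Q r3.
  apply/subsetP => u; rewrite !inE /lrel lv; case: (u \in S) => //=.
  by case: (lab u) => -[[]|] j; rewrite ?xpair_eqE /=; clear - k0; lia.
have c1 : #|Q r1| <= 1.
  apply: clique_card => // x y; rewrite !inE => /or3P[] /eqP-> /or3P[] /eqP-> //=;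
  rewrite ?eqxx //; clear - k0; lia.
have c2 : #|Q r2| <= 1.
  apply: clique_card => // x y; rewrite !inE => /or3P[] /eqP-> /or3P[] /eqP-> //=;
  rewrite ?eqxx //; clear - k0; lia.
have c3 : #|Q r3| <= 1.
  apply: clique_card => // x y; rewrite !inE => /orP[] /eqP-> /orP[] /eqP-> //=;
  rewrite ?eqxx //; clear - k0; lia.
have le : #|nbrs v S| <= #|Q r1| + #|Q r2| + #|Q r3|.
  apply: leq_trans (subset_leq_card sub) _; apply: leq_trans (leq_card_setU _ _) _.
  by rewrite leq_add2r leq_card_setU.
split; first by clear - le c1 c2 c3; lia.
move=> E; have [n1 n2 n3] : [/\ 0 < #|Q r1|, 0 < #|Q r2| & 0 < #|Q r3|].
  by split; clear - le c1 c2 c3 E; lia.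
have ex r : 0 < #|Q r| -> exists2 x, x \in r & has_label S x.
  by rewrite card_gt0 => /set0Pn[u]; rewrite inE => /andP[uS ur]; exists (lab u);
    rewrite ?has_label_lab.
have [x xr xS] := ex _ n1; have [y yr yS] := ex _ n2; have [z zr zS] := ex _ n3.
have xy := stable_label Sst xS yS; have yz := stable_label Sst yS zS.
have xz := stable_label Sst xS zS; clear - k0 xr yr zr xS yS zS xy yz xz.
(* A neighbourhood of size three takes one vertex from each clique. Of the eighteen choices, only
   the two of the statement contain no edge. *)
move: xr yr zr xS yS zS xy yz xz; rewrite !inE => /or3P[] /eqP-> /or3P[] /eqP-> /orP[] /eqP->;
move=> xS yS zS /=; try (clear - k0; lia).
all: by rewrite ?xS ?yS ?zS /=; auto.
Qed.

End Degrees.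

Section Exits.
Variables S S' K : {set T}.
Hypotheses (Sst : stable lrel S) (S'st : stable lrel S').
Hypothesis Kcl : forall u v, u \in K -> v \in S :|: S' -> lrel u v -> v \in K.

Local Notation p := (has_label S).
Local Notation q := (has_label S').

Let pP x y := @stable_label S x y Sst.
Let qP x y := @stable_label S' x y S'st.

Definition exit_of (v w : T) : Prop := exists s m n,
  [/\ lab v = (KO, m), right_claw p q s m, run p q m n & lab w \in run_exits n].

Lemma has_label_range (X : {set T}) x : has_label X x -> in_range N x.
Proof. by case/has_labelP => v _ <-. Qed.

Lemma has_label_KO0 (X : {set T}) : has_label X (KO, 0) = false.
Proof. by case E: (has_label _ _) => //; have := has_label_range E. Qed.

Lemma has_label_KE0 (X : {set T}) : has_label X (KE, 0) = false.
Proof. by case E: (has_label _ _) => //; have := has_label_range E. Qed.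

Lemma exit_of_inj v v' w : exit_of v w -> exit_of v' w -> v = v'.
Proof.
move=> [s [m [n [lv cl rn wn]]]] [s' [m' [n' [lv' cl' rn' wn']]]].
apply: lab_inj; rewrite lv lv'; congr (_, _).
exact: (run_end_unique pP qP (has_label_KO0 S') (has_label_KE0 S') cl rn cl' rn' wn wn').
Qed.

Lemma exit_exists v m : v \in S -> v \in K -> lab v = (KO, m) -> #|nbrs v S'| = 3 ->
  (forall s n, valid N m n -> ~~ claw_at true s m n S S') ->
  exists w, [/\ w \in S, w \in K, #|nbrs w S'| <= 1 & exit_of v w].
Proof.
move=> vS vK lv d3 noex; have [_ /(_ d3) [qB cl]] := nbrs_KO S'st lv.
have {qB}cl : exists s, right_claw p q s m.
  have pm : p (KO, m) by rewrite -lv has_label_lab.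
  by case: cl => c; [exists true | exists false]; rewrite /right_claw pm qB.
case: cl => s cl.
have qO := has_label_KO0 S'; have qE := has_label_KE0 S'.
have qB k : q (KB, k) -> k <= N by move=> H; apply: has_label_range H.
have [||||n [x [rn xn /has_labelP[w wS lw] /has_labelP[w' wK lw'] q4]]] :=
  @run_exit N p q pP qP qO qE qB s m (has_label K).
- move=> x y /has_labelP[u uK <-] xy adj; have [u' u'S lu'] : exists2 u', u' \in S :|: S' & lab u' = y.
    by case/orP: xy => /has_labelP[u' u'S <-]; exists u' => //; rewrite inE u'S ?orbT.
  by rewrite -lu' has_label_lab; apply: Kcl uK u'S _; rewrite /lrel lu'.
- move=> n vmn [H1 H2]; case/negP: (noex s n vmn); apply/claw_atP; split=> u Hu.
    by rewrite -H1 ?has_label_lab.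
  by rewrite -H2 ?has_label_lab.
- exact: cl.
- by rewrite -lv has_label_lab.
have Ew : w' = w by apply: lab_inj; rewrite lw'.
rewrite {}Ew {w' lw'} in wK; exists w; split=> //; last first.
  by exists s, m, n; split; rewrite ?lw.
have [mn od rnP] := rn; have /andP[pn qn] := rnP n mn (leqnn _) ltac:(by rewrite addnC).
apply/card_le1_eqP => y z; rewrite !inE => /andP[yS wy] /andP[zS wz]; apply: lab_inj.
apply: (dead_end qP qO qE qn (run_lower qO qE cl rn) q4 xn);
  by rewrite ?has_label_lab // -lw.
Qed.

(** This tells exits to the right from mirrored ones: a [KE] exit has a neighbour in [S'] inside the
    clique on its left. *)
Lemma exit_side v w : exit_of v w ->
  exists k, lab w = (KO, k) \/
    lab w = (KE, k) /\ exists2 u, u \in S' &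
      [/\ ladj (KE, k) (lab u) & lab u \in [:: (KE, k.-1); (KB, k.-1); (KB, k)]].
Proof.
move=> [s [m [n [lv cl rn]]]]; rewrite !inE => /or3P[] /eqP->.
- exists n.+1; right; split=> //; have := run_lower (has_label_KO0 S') (has_label_KE0 S') cl rn.
  by case/orP=> /has_labelP[u uS lu]; exists u => //; rewrite lu; split;
    rewrite ?inE ?eqxx ?orbT //= eqxx ?orbT.
- exists n.+2; right; split=> //.
  have [mn od rnP] := rn; have /andP[pn] := rnP n mn (leqnn _) ltac:(by rewrite addnC).
  by case/has_labelP=> u uS lu; exists u => //; rewrite lu; split;
    rewrite ?inE ?eqxx ?orbT //= eqxx.
by exists n.+2; left.
Qed.

End Exits.
End LabelledGraph.

(** * The average degree on one side of a component *)

Section DegreeSum.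
Variables (T : finType) (lab : T -> label) (N : nat).
Hypothesis lab_inj : injective lab.
Hypothesis lab_range : forall v, in_range N (lab v).

Let lab' v := flip N.+1 (lab v).

Lemma lab'_inj : injective lab'.
Proof.
move=> u v E; apply: lab_inj.
have := congr1 (flip N.+1) E; rewrite /lab' !flipK //; exact: in_range_le.
Qed.

Lemma lab'_range v : in_range N (lab' v).
Proof. exact/in_range_flip/lab_range. Qed.

Lemma lrel_flip u v : lrel lab' u v = lrel lab u v.
Proof. by rewrite /lrel ladj_flip // in_range_le. Qed.

Lemma nbrs_flip v S : nbrs lab' v S = nbrs lab v S.
Proof. by apply/setP => u; rewrite !inE lrel_flip. Qed.

Lemma stable_flip S : stable (lrel lab') S = stable (lrel lab) S.
Proof.
by apply/stableP/stableP => H u v uS vS; [rewrite -lrel_flip|rewrite lrel_flip]; apply: H.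
Qed.

Lemma claw_at_flip t s m n C L : valid N m n ->
  claw_at lab' t s (N - n) (N - m) C L = claw_at lab (~~ t) (~~ s) m n C L.
Proof.
case/and4P=> m1 mn od nN.
have E v d : win d (N - n) (N - m) (lab' v).2 = win d m n (lab v).2.
  have := in_range_le (lab_range v); rewrite /win /lab' /=; clear - m1 mn nN; lia.
have CE v : centre t (N - n) (N - m) (lab' v) = centre (~~ t) m n (lab v).
  by rewrite -[N - n]subSS -[N - m]subSS centre_flip ?in_range_le // ltnS ltnW // ltnW.
have LE v : leaf t s (N - n) (N - m) (lab' v) = leaf (~~ t) (~~ s) m n (lab v).
  by rewrite -[N - n]subSS -[N - m]subSS leaf_flip ?in_range_le // ?ltnS ltnW // ltnW.
by apply/claw_atP/claw_atP => -[H1 H2]; split=> v; move: (H1 v) (H2 v);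
  rewrite ?E ?CE ?LE; auto.
Qed.

Lemma valid_flip m n : valid N m n -> valid N (N - n) (N - m).
Proof. rewrite /valid; lia. Qed.

Variables S S' K : {set T}.
Hypotheses (Sst : stable (lrel lab) S) (S'st : stable (lrel lab) S').
Hypothesis Kcl : forall u v, u \in K -> v \in S :|: S' -> lrel lab u v -> v \in K.
Hypothesis noclaw : forall t s m n, valid N m n -> ~~ claw_at lab t s m n S S'.

Let deg v := #|nbrs lab v S'|.

Let S'st' : stable (lrel lab') S'. Proof. by rewrite stable_flip. Qed.

Lemma deg_le3 v : deg v <= 3.
Proof.
case lv: (lab v) => [[[]|] k].
- by have [] := nbrs_KO lab_inj lab_range S'st lv.
- by rewrite /deg -nbrs_flip;
    have [] := @nbrs_KO _ lab' _ lab'_inj lab'_range _ S'st' v (N.+1 - k); rewrite ?/lab' ?lv.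
by apply: leq_trans (nbrs_KE lab_inj lab_range S'st lv) _.
Qed.

Definition exits (v w : T) := exit_of lab S S' v w \/ exit_of lab' S S' v w.

Lemma exits_exist v : v \in S -> v \in K -> deg v = 3 ->
  exists w, [/\ w \in S, w \in K, deg w <= 1 & exits v w].
Proof.
move=> vS vK d3; case lv: (lab v) => [[[]|] k].
- have [|w [wS wK dw ex]] := exit_exists lab_inj lab_range Sst S'st Kcl vS vK lv d3.
    by move=> s n; apply: noclaw.
  by exists w; split=> //; left.
- have lv' : lab' v = (KO, N.+1 - k) by rewrite /lab' lv.
  have [||||w [wS wK dw ex]] :=
    @exit_exists _ lab' N lab'_inj lab'_range S S' K _ S'st' _ v _ vS vK lv'.
  + by rewrite stable_flip.
  + by move=> u w uK wS; rewrite lrel_flip; apply: Kcl.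
  + by rewrite nbrs_flip.
  + move=> s n vn; have vn' := valid_flip vn.
    rewrite -{1}[N.+1 - k](_ : N - (N - (N.+1 - k)) = _) 1?[n in claw_at _ _ _ _ n](_ : n = N - (N - n));
      try by move: vn; rewrite /valid; clear; lia.
    by rewrite claw_at_flip //; apply: noclaw.
  by exists w; split=> //; [rewrite /deg -nbrs_flip | right].
by have := nbrs_KE lab_inj lab_range S'st lv; rewrite -/(deg v) d3.
Qed.

(** A right exit is a [KO] or a [KE], a left exit a [KB] or a [KE]. A common [KE] would have its
    only neighbour both in the clique on its left and in the clique on its right, which are
    disjoint. *)
Lemma exit_of_flip_disjoint v v' w : deg w <= 1 ->
  exit_of lab S S' v w -> exit_of lab' S S' v' w -> False.
Proof.
move=> dw e1 e2; have [k H1] := exit_side lab_range e1.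
have [k' H2] := exit_side lab'_range e2; move/card_le1_eqP: dw => dw.
have : in_range N (lab' w) := lab'_range w; rewrite /lab'.
case: H1 => [lw|[lw [u uS [wu lu]]]].
  by case: H2 => [|[]]; rewrite /lab' lw.
case: H2 => [|[+ [u' u'S [wu' lu']]]]; rewrite /lab' lw //= => -[Ek] rg.
have lu2 : lab u' \in [:: (KE, k.+1); (KO, k.+1); (KO, k)].
  move: lu' (in_range_le (lab_range u')); rewrite /lab' !inE -Ek.
  by case: (lab u') => -[[]|] j; rewrite ?xpair_eqE /=; clear -rg; lia.
have Eu : u = u'.
  apply: dw; rewrite inE ?uS ?u'S /= /lrel lw //.
  by move: lu2; rewrite !inE => /or3P[] /eqP->; rewrite /= eqxx ?orbT.
move: lu lu2; rewrite Eu !inE; clear -rg; case: (lab u') => -[[]|] j; rewrite ?xpair_eqE /=; lia.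
Qed.

Lemma exits_inj v v' w : deg w <= 1 -> exits v w -> exits v' w -> v = v'.
Proof.
move=> dw [e1|e1] [e2|e2].
- exact: (exit_of_inj lab_inj lab_range Sst S'st e1 e2).
- by case: (exit_of_flip_disjoint dw e1 e2).
- by case: (exit_of_flip_disjoint dw e2 e1).
by apply: (exit_of_inj lab'_inj lab'_range _ S'st' e1 e2); rewrite stable_flip.
Qed.

(** Sending each vertex of degree 3 to an exit of degree at most 1 is injective, so the excesses
    over 2 are compensated inside [K] and [S]. *)
Lemma degree_sum : \sum_(v in K :&: S) deg v <= (#|K :&: S|).*2.
Proof.
pose V3 := [set v in K :&: S | deg v == 3]; pose V1 := [set v in K :&: S | deg v <= 1].
have le31 : #|V3| <= #|V1|.
  have [f fP] : exists f : T -> T, forall v, v \in V3 -> f v \in V1 /\ exits v (f v).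
    apply: (@fin_all_exists _ (fun=> T) (fun v w => v \in V3 -> w \in V1 /\ exits v w)).
    move=> v; case: (boolP (v \in V3)) => [|_]; last by exists v.
    rewrite inE inE => /andP[/andP[vK vS] /eqP /(exits_exist vS vK)[w [wS wK dw ex]]].
    by exists w; rewrite inE inE wS wK.
  rewrite -(card_in_imset (f := f)).
    by apply/subset_leq_card/subsetP => _ /imsetP[v /fP[fv _] ->].
  move=> v v' /fP[+ ex] /fP[_ ex'] E; rewrite inE => /andP[_ dw].
  by apply: exits_inj dw ex _; rewrite E.
(* Termwise, because degrees are at most 3; [le31] then compares the two indicator sums. *)
have : \sum_(v in K :&: S) (deg v + (deg v <= 1)) <= \sum_(v in K :&: S) (2 + (deg v == 3)).
  by apply: leq_sum => v _; have := deg_le3 v; case: (deg v) => [|[|[|[]]]].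
have cardE (P : pred T) : #|[set v in K :&: S | P v]| = \sum_(v in K :&: S) P v.
  by rewrite -sum1_card big_mkcond [RHS]big_mkcond; apply: eq_bigr => v _;
    rewrite inE; case: (v \in _) => //; case: (P v).
rewrite !big_split /= sum_nat_const -!cardE -/V1 -/V3.
by clear -le31; lia.
Qed.

End DegreeSum.

(** * Swapping an odd component *)

Section Swap.
Variables (T : finType) (e : rel T).
Hypothesis e_sym : symmetric e.

Lemma edgesC X Y : edges e X Y = edges e Y X.
Proof.
rewrite /edges exchange_big /=; apply: eq_bigr => u _; apply: eq_bigr => v _.
by rewrite e_sym.
Qed.

Lemma edges_setID X Y Z : edges e X Z = edges e (X :&: Y) Z + edges e (X :\: Y) Z.
Proof. by rewrite /edges (big_setID Y). Qed.

Lemma edges_eq0 (X Y : {set T}) : (forall u v, u \in X -> v \in Y -> ~~ e u v) -> edges e X Y = 0.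
Proof.
by move=> H; rewrite /edges big1 // => u uX; rewrite big1 // => v vY;
  rewrite (negbTE (H u v uX vY)).
Qed.

Lemma edges_gt0 (X Y : {set T}) u v : u \in X -> v \in Y -> e u v -> 0 < edges e X Y.
Proof. by move=> uX vY uv; rewrite /edges (bigD1 u) //= (bigD1 v) //= uv. Qed.

(** Growing a subset one vertex at a time uses a new edge at each step, and [edges e K K] counts
    every edge twice. *)
Lemma edges_connected (K : {set T}) :
  (forall X : {set T}, X \proper K -> X != set0 ->
     exists u v, [/\ u \in X, v \in K :\: X & e u v]) ->
  K != set0 -> (#|K|.-1).*2 <= edges e K K.
Proof.
move=> conn K0.
have grow n : n < #|K| -> exists X : {set T}, [/\ X \subset K, #|X| = n.+1 & n.*2 <= edges e X X].
  elim: n => [|n IH] nK.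
    by case/set0Pn: K0 => v vK; exists [set v]; rewrite sub1set cards1.
  have [X [XK Xn Xe]] := IH (ltnW nK).
  have [u [v [uX]]] : exists u v, [/\ u \in X, v \in K :\: X & e u v].
    apply: conn; last by rewrite -card_gt0 Xn.
    by rewrite properEcard XK Xn.
  rewrite inE => /andP[vX vK] uv; exists (v |: X); split.
  - by rewrite subUset sub1set vK.
  - by rewrite cardsU1 vX Xn.
  have I1 : (v |: X) :&: X = X by apply/setIidPr/subsetUr.
  have I2 : (v |: X) :\: X = [set v].
    by apply/setP => w; rewrite !inE; case: eqP => [->|]; rewrite ?vX //=; case: (w \in X).
  have EZ Z : edges e (v |: X) Z = edges e X Z + edges e [set v] Z.
    by rewrite (edges_setID _ X) I1 I2.
  rewrite EZ [edges e X (_ |: _)]edgesC [edges e [set v] (_ |: _)]edgesC !EZ.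
  have p1 : 0 < edges e [set v] X by apply: (edges_gt0 (set11 v) uX); rewrite e_sym.
  rewrite [edges e X [set v]]edgesC.
  by clear - p1 Xe; lia.
have [X [XK Xn Xe]] := grow #|K|.-1 ltac:(by rewrite prednK ?card_gt0).
have -> : K = X; last by rewrite Xn.
by apply/esym/eqP; rewrite eqEcard XK Xn prednK ?leqnn // card_gt0.
Qed.

Definition sdiff (p : {set T} * {set T}) := (p.1 :\: p.2) :|: (p.2 :\: p.1).

Definition closed_in (D K : {set T}) := [forall u in K, forall v in D, e u v ==> (v \in K)].

Lemma closed_inP (D K : {set T}) :
  reflect (forall u v, u \in K -> v \in D -> e u v -> v \in K) (closed_in D K).
Proof.
apply: (iffP forall_inP) => [H u v /H /forall_inP H' /H' /implyP //|H u uK].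
by apply/forall_inP => v vD; apply/implyP; apply: H.
Qed.

Definition odd_part (D K : {set T}) := [&& K \subset D, closed_in D K & odd (edges e K K)./2].

(** Chosen as a function of [D] only, so that [swap] is an involution; minimality makes it
    connected. *)
Definition odd_comp (D : {set T}) := odflt set0 [pick K | minset (odd_part D) K].

Definition swap_on (K : {set T}) (p : {set T} * {set T}) :=
  (p.1 :\: K :|: p.2 :&: K, p.2 :\: K :|: p.1 :&: K).

Definition swap p := swap_on (odd_comp (sdiff p)) p.

Lemma swap_onK K : involutive (swap_on K).
Proof.
move=> [S S']; rewrite /swap_on /=; congr (_, _); apply/setP => v;
by rewrite !inE; case: (v \in K); case: (v \in S); case: (v \in S').
Qed.

Lemma sdiff_swap_on K p : sdiff (swap_on K p) = sdiff p.
Proof.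
apply/setP => v; rewrite !inE.
by case: (v \in K); case: (v \in p.1); case: (v \in p.2).
Qed.

Lemma swapK : involutive swap.
Proof. by move=> p; rewrite /swap sdiff_swap_on swap_onK. Qed.

Section Pair.
Variable p : {set T} * {set T}.
Hypotheses (st1 : stable e p.1) (st2 : stable e p.2).

Lemma sdiff_edges (K : {set T}) : K \subset sdiff p -> edges e K K = (edges e (K :&: p.1) (K :&: p.2)).*2.
Proof.
move=> /subsetP KD; set X := K :&: p.1; set Y := K :&: p.2.
have XY : K :\: p.1 = Y.
  apply/setP => v; rewrite !inE; case vK: (v \in K); rewrite ?andbF //= andbT.
  by have := KD v vK; rewrite !inE; case: (v \in p.1); case: (v \in p.2).
have EZ Z : edges e K Z = edges e X Z + edges e Y Z.
  by rewrite (edges_setID _ p.1) XY.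
rewrite EZ [edges e X K]edgesC [edges e Y K]edgesC !EZ.
rewrite (@edges_eq0 X X); last first.
  by move=> u v; rewrite !inE => /andP[_ u1] /andP[_ v1]; move/stableP: st1; apply.
rewrite (@edges_eq0 Y Y); last first.
  by move=> u v; rewrite !inE => /andP[_ u1] /andP[_ v1]; move/stableP: st2; apply.
by rewrite add0n addn0 edgesC addnn.
Qed.

(** A vertex common to both stable sets has no neighbour in either, so every edge between them lies
    in the symmetric difference. *)
Lemma sdiff_edges_all : edges e (sdiff p) (sdiff p) = (edges e p.1 p.2).*2.
Proof.
rewrite sdiff_edges //; congr _.*2.
have -> : sdiff p :&: p.1 = p.1 :\: p.2.
  by apply/setP => v; rewrite !inE; case: (v \in p.1); case: (v \in p.2).
have -> : sdiff p :&: p.2 = p.2 :\: p.1.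
  by apply/setP => v; rewrite !inE; case: (v \in p.1); case: (v \in p.2).
rewrite [RHS](edges_setID _ p.2) (@edges_eq0 (p.1 :&: p.2)) ?add0n; last first.
  by move=> u v; rewrite inE => /andP[_ u2] v2; move/stableP: st2; apply.
rewrite [RHS]edgesC [RHS](edges_setID _ p.1) (@edges_eq0 (p.2 :&: p.1)) ?add0n; first exact: edgesC.
by move=> u v; rewrite !inE => /andP[_ u1] /andP[_ v1]; move/stableP: st1; apply.
Qed.

Lemma closed_in_union (K : {set T}) u v : K \subset sdiff p -> closed_in (sdiff p) K ->
  u \in K -> v \in p.1 :|: p.2 -> e u v -> v \in K.
Proof.
move=> /subsetP KD /closed_inP Kc uK vU uv; apply: (Kc u) => //.
move: (KD u uK) vU; rewrite !inE.
have s1 : u \in p.1 -> v \in p.1 -> False.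
  by move=> u1 v1; move/stableP: st1 => /(_ u v u1 v1); rewrite uv.
have s2 : u \in p.2 -> v \in p.2 -> False.
  by move=> u1 v1; move/stableP: st2 => /(_ u v u1 v1); rewrite uv.
move: s1 s2; case: (u \in p.1); case: (u \in p.2); case: (v \in p.1); case: (v \in p.2) => //= s1 s2.
- by case: s1.
- by case: s2.
Qed.

(** Without an edge leaving [X], both [X] and its complement in [K] would be closed. Their edge
    counts add up to an odd number, so one of them would be a smaller odd part. *)
Lemma minset_connected (K X : {set T}) : minset (odd_part (sdiff p)) K -> X \proper K -> X != set0 ->
  exists u v, [/\ u \in X, v \in K :\: X & e u v].
Proof.
move=> /minsetP[/and3P[KD /closed_inP Kc Ko] Kmin] XK X0.
have [/existsP[u /existsP[v /and3P[uX vX uv]]]|none] :=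
  boolP [exists u, exists v, [&& u \in X, v \in K :\: X & e u v]]; first by exists u, v.
have no u v : u \in X -> v \in K :\: X -> ~~ e u v.
  move=> uX vX; apply: contra none => uv; apply/existsP; exists u; apply/existsP; exists v.
  by rewrite uX vX.
have XsK := proper_sub XK; have IX : K :&: X = X by apply/setIidPr.
have cX : closed_in (sdiff p) X.
  apply/closed_inP => u v uX vD uv; apply: contraT => vX.
  have vK : v \in K by apply: Kc uv => //; apply: (subsetP XsK).
  by have := no u v uX; rewrite inE vX vK uv => /(_ isT).
have cY : closed_in (sdiff p) (K :\: X).
  apply/closed_inP => u v; rewrite inE => /andP[uX uK] vD uv.
  rewrite inE (Kc u v uK vD uv) andbT; apply/negP => vX.
  by have := no v u vX; rewrite inE uX uK e_sym uv => /(_ isT).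
have XD := subset_trans XsK KD.
have YD : K :\: X \subset sdiff p by apply: subset_trans (subsetDl _ _) KD.
have eK : edges e K K = edges e X X + edges e (K :\: X) (K :\: X).
  have EZ Z : edges e K Z = edges e X Z + edges e (K :\: X) Z.
    by rewrite (edges_setID _ X) IX.
  rewrite EZ [edges e X K]edgesC [edges e (K :\: X) K]edgesC !EZ.
  by rewrite [edges e (K :\: X) X]edgesC (@edges_eq0 X (K :\: X)) // addn0 add0n.
move: Ko; rewrite eK (sdiff_edges XD) (sdiff_edges YD) -doubleD doubleK oddD.
case oX: (odd (edges e (X :&: p.1) (X :&: p.2))) => /= oY.
  suff E : X = K by move: XK; rewrite E properxx.
  by apply: Kmin XsK; rewrite /odd_part XD cX (sdiff_edges XD) doubleK oX.
suff E : K :\: X = K.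
  case/set0Pn: X0 => v vX; have := subsetP XsK v vX.
  by rewrite -E inE vX.
by apply: Kmin (subsetDl _ _); rewrite /odd_part YD cY (sdiff_edges YD) doubleK oY.
Qed.

Hypothesis deg1 : forall K : {set T}, (forall u v, u \in K -> v \in p.1 :|: p.2 -> e u v -> v \in K) ->
  edges e (K :&: p.1) p.2 <= (#|K :&: p.1|).*2.
Hypothesis deg2 : forall K : {set T}, (forall u v, u \in K -> v \in p.1 :|: p.2 -> e u v -> v \in K) ->
  edges e (K :&: p.2) p.1 <= (#|K :&: p.2|).*2.
Hypothesis odd_p : odd (edges e p.1 p.2).

Let K := odd_comp (sdiff p).

Lemma odd_comp_min : minset (odd_part (sdiff p)) K.
Proof.
rewrite /K /odd_comp; case: pickP => //= none.
have [|M mM _] := @minset_exists _ (odd_part (sdiff p)) (sdiff p).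
  rewrite /odd_part subxx sdiff_edges_all doubleK odd_p andbT /=.
  by apply/closed_inP.
by have := none M; rewrite mM.
Qed.

Lemma odd_comp_sub : K \subset sdiff p.
Proof. by have /minsetP[/and3P[]] := odd_comp_min. Qed.

Lemma odd_comp_closed u v : u \in K -> v \in p.1 :|: p.2 -> e u v -> v \in K.
Proof.
have /minsetP[/and3P[_ Kc _] _] := odd_comp_min.
exact: closed_in_union odd_comp_sub Kc.
Qed.

Lemma odd_comp_odd : odd (edges e (K :&: p.1) (K :&: p.2)).
Proof.
have /minsetP[/and3P[KD _]] := odd_comp_min.
by rewrite sdiff_edges // doubleK.
Qed.

Lemma odd_comp_card : #|K| = #|K :&: p.1| + #|K :&: p.2|.
Proof.
rewrite -(cardsID p.1 K); congr (_ + #|pred_of_set _|); apply/setP => v; rewrite !inE.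
have := subsetP odd_comp_sub v; rewrite !inE.
by case: (v \in K); case: (v \in p.1); case: (v \in p.2) => //= /(_ isT).
Qed.

(** Let [a] and [b] be the two cardinals and [E] the number of edges. Connectedness gives
    [a + b - 1 <= E], and the degree bounds give [E <= 2a] and [E <= 2b]; since [E] is odd, these
    improve to [2a - 1] and [2b - 1], whence [a = b]. *)
Lemma odd_comp_balanced : #|K :&: p.1| = #|K :&: p.2|.
Proof.
have K0 : K != set0.
  apply: contraTneq odd_comp_odd => ->; rewrite set0I /edges big1 // => u.
  by rewrite inE.
have := edges_connected (fun X => @minset_connected K X odd_comp_min) K0.
have := odd_comp_odd; rewrite (sdiff_edges odd_comp_sub) odd_comp_card.
have e1 : edges e (K :&: p.1) (K :&: p.2) <= edges e (K :&: p.1) p.2.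
  by rewrite edgesC [X in _ <= X]edgesC [X in _ <= X](edges_setID _ K) setIC leq_addr.
have e2 : edges e (K :&: p.1) (K :&: p.2) <= edges e (K :&: p.2) p.1.
  by rewrite [X in _ <= X]edgesC [X in _ <= X](edges_setID _ K) setIC leq_addr.
have := leq_trans e1 (deg1 odd_comp_closed); have := leq_trans e2 (deg2 odd_comp_closed).
by clear; lia.
Qed.

Lemma swap_card : #|(swap p).1| = #|p.1| /\ #|(swap p).2| = #|p.2|.
Proof.
have c (A B : {set T}) : #|A :\: K :|: B :&: K| = #|A :\: K| + #|B :&: K|.
  rewrite cardsU (_ : (A :\: K) :&: (B :&: K) = set0) ?cards0 ?subn0 //.
  by apply/setP => v; rewrite !inE; case: (v \in K); rewrite ?andbF.
rewrite /swap /= -/K !c -(cardsID K p.1) -(cardsID K p.2).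
by have := odd_comp_balanced; rewrite ![K :&: _]setIC => ->; rewrite ![_ + #|_ :\: _|]addnC.
Qed.

Lemma swap_stable : stable e (swap p).1 /\ stable e (swap p).2.
Proof.
have key (A B : {set T}) : stable e A -> stable e B -> A :|: B = p.1 :|: p.2 ->
    stable e (A :\: K :|: B :&: K).
  move=> /stableP sA /stableP sB AB; apply/stableP.
  have cross u v : u \in A :\: K -> v \in B :&: K -> ~~ e v u.
    rewrite !inE => /andP[uK uA] /andP[vB vK]; apply: contra uK => /(odd_comp_closed vK).
    by apply; rewrite -AB inE uA.
  move=> u v /setUP[uA|uB] /setUP[vA|vB].
  - by apply: sA; [case/setDP: uA | case/setDP: vA].
  - by rewrite e_sym; apply: cross.
  - exact: cross.
  - by apply: sB; [case/setIP: uB | case/setIP: vB].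
by split; apply: key => //; rewrite setUC.
Qed.

End Pair.

Section SwapMon.
Variables (R : nzRingType) (g : T -> R).
Local Open Scope ring_scope.
Hypothesis gC : forall u v, g u * g v = (-1) ^+ e u v * (g v * g u).
Local Notation mon := (mon g).

(** Each monomial is split so that the factors in [K] stand side by side in the product. The swap
    exchanges just these two, at the cost of an odd number of signs. *)
Lemma swap_mon p : stable e p.1 -> stable e p.2 ->
  odd (edges e p.1 p.2) ->
  mon (swap p).1 * mon (swap p).2 = - (mon p.1 * mon p.2).
Proof.
move=> s1 s2 od; have [t1 t2] := swap_stable s1 s2 od.
set K := odd_comp (sdiff p).
have dj (A B : {set T}) : [disjoint A :\: K & B :&: K].
  by rewrite disjoints_subset; apply/subsetP => v; rewrite !inE; case: (v \in K); rewrite ?andbF.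
have dj' (A B : {set T}) : [disjoint A :&: K & B :\: K] by rewrite disjoint_sym.
have E1 : mon p.1 = mon (p.1 :\: K) * mon (p.1 :&: K).
  by rewrite -(mon_setU gC) // setUC setID.
have E2 : mon p.2 = mon (p.2 :&: K) * mon (p.2 :\: K).
  by rewrite -(mon_setU gC) // setID.
have -> : mon (swap p).1 = mon (p.1 :\: K) * mon (p.2 :&: K).
  by rewrite -(mon_setU gC).
have -> : mon (swap p).2 = mon (p.1 :&: K) * mon (p.2 :\: K).
  by rewrite -(mon_setU gC) //= setUC.
have := odd_comp_odd s1 s2 od; rewrite -/K ![K :&: _]setIC => oK.
have := monC gC (p.1 :&: K) (p.2 :&: K); rewrite -signr_odd oK mulN1r => E.
rewrite E1 E2 -mulrA -[in RHS]mulrA [in RHS](mulrA (mon (p.1 :&: K))) E.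
by rewrite mulNr mulrN opprK !mulrA.
Qed.

End SwapMon.
End Swap.

(** * Swapping preserves claw chains *)

Section ClawConnected.
Variables (N : nat) (p q c : label -> bool) (t s : bool) (m n : nat).
Hypothesis vmn : valid N m n.
Hypothesis pE : forall a k, 0 < k -> k <= N -> win 1 m n k -> p (a, k) = centre t m n (a, k).
Hypothesis qE : forall a k, 0 < k -> k <= N -> win 2 m n k -> q (a, k) = leaf t s m n (a, k).
Hypothesis cE : forall x y, p x || q x -> p y || q y -> ladj x y -> c x = c y.

Let m1 : 1 < m. Proof. by case/and4P: vmn. Qed.
Let mn : m <= n. Proof. by case/and4P: vmn. Qed.
Let odmn : ~~ odd (m + n). Proof. by case/and4P: vmn. Qed.
Let nN : n.+2 <= N. Proof. by case/and4P: vmn. Qed.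

Lemma centre_p x : centre t m n x -> p x.
Proof.
case: x => a k cx; have := centre_width cx => /= W.
by rewrite pE // /win; clear - W m1 nN; lia.
Qed.

Lemma leaf_q x : leaf t s m n x -> q x.
Proof.
case: x => a k cx; have /= W := leaf_width (ltnW m1) mn cx.
by rewrite qE // /win; clear - W m1 nN; lia.
Qed.

Lemma centre_leafE x y : centre t m n x -> leaf t s m n y -> ladj x y -> c x = c y.
Proof. by move=> /centre_p px /leaf_q qy; apply: cE; rewrite ?px ?qy ?orbT. Qed.

Let base j : label := if t then (KO, m + j.*2) else (KB, (m + j.*2).+1).

Lemma base_centre j : m + j.*2 <= n -> centre t m n (base j).
Proof. by move=> jn; rewrite /base; case: t => /=; clear - jn; lia. Qed.

Lemma base_const j : m + j.*2 <= n -> c (base j) = c (base 0).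
Proof.
elim: j => // j IH jn; have jn' : m + j.*2 <= n by clear - jn; lia.
rewrite -IH //; pose x : label := if t then (KB, (m + j.*2).+2) else (KO, (m + j.*2).+1).
have lx : leaf t s m n x by rewrite /x; case: t => /=; clear - jn odmn; lia.
by transitivity (c x); [|symmetry]; apply: centre_leafE lx _ => //;
  try exact: base_centre; rewrite /base /x; case: t => /=; clear; lia.
Qed.

Lemma centre_const x : centre t m n x -> c x = c (base 0).
Proof.
case: x => a k cx; have {cx}[j jn ->] : exists2 j, m + j.*2 <= n & (a, k) = base j.
  exists ((k - m)./2); move: cx; rewrite /base; case: t; case: a => [[]|] //=.
  - by clear - m1 mn odmn; lia.
  - by clear - m1 mn odmn; lia.
  - by move=> H; congr (_, _); clear - H odmn; lia.
  - by move=> H; congr (_, _); clear - H odmn; lia.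
exact: base_const.
Qed.

Lemma leaf_const x : leaf t s m n x -> c x = c (base 0).
Proof.
move=> lx; have [y cy yx] : exists2 y, centre t m n y & ladj y x.
  case: x lx => a k; case: t.
    exists (KO, if (a == KB) && (k != m) then k.-2 else m).
      by move: lx; case: a => [[]|]; case: s => /=; do ?case: ifP; clear - mn odmn m1; lia.
    by move: lx; case: a => [[]|]; case: s => /=; do ?case: ifP; clear - mn odmn m1; lia.
  exists (KB, if (a == KO) && (k != n.+1) then k.+2 else n.+1).
    by move: lx; case: a => [[]|]; case: s => /=; do ?case: ifP; clear - mn odmn m1; lia.
  by move: lx; case: a => [[]|]; case: s => /=; do ?case: ifP; clear - mn odmn m1; lia.
by rewrite -(centre_const cy); symmetry; apply: centre_leafE.
Qed.

(** The tree is connected, so [c] is constant on it; this has to reach also the stray vertices of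
    the wider window. *)
Lemma claw_const x : in_range N x -> p x || q x -> win 2 m n x.2 -> c x = c (base 0).
Proof.
case: x => a k rg pq; rewrite /win /= => W.
have [kin|kout] := boolP ((0 < k) && (k <= N) && win 1 m n k).
  case/andP: kin => /andP[k0 kN] W1; case/orP: pq => [|qx].
    by rewrite pE // => /centre_const.
  by apply: leaf_const; rewrite -qE.
(* What remains lies in the extreme columns [m-2] and [n+3], where every vertex in range is adjacent
   to some leaf. *)
have [l ll la] : exists2 l, leaf t s m n l & ladj (a, k) l.
  have [lo|hi] : k.+2 = m \/ k = n + 3.
    move: kout rg; rewrite /win; case: (a) => [[]|] /=; clear - W m1 nN mn; lia.
  - exists (if t && ~~ s then if a == KO then (KB, m) else (KE, m.-1) else (KO, m.-1)).
      by case: t; case: s; case: a {rg pq} => [[]|] /=; clear - lo m1 mn odmn; lia.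
    by case: t; case: s; case: a {rg pq} => [[]|] /=; clear - lo m1 mn odmn; lia.
  exists (if ~~ t && s then if a == KB then (KO, n.+1) else (KE, n.+2) else (KB, n.+2)).
    by case: t; case: s; case: a {rg pq} => [[]|] /=; clear - hi m1 mn odmn; lia.
  by case: t; case: s; case: a {rg pq} => [[]|] /=; clear - hi m1 mn odmn; lia.
by rewrite -(leaf_const ll); apply: cE la => //; rewrite (leaf_q ll) orbT.
Qed.

End ClawConnected.

Section ClawSwap.
Variables (T : finType) (lab : T -> label) (N : nat).
Hypothesis lab_inj : injective lab.
Hypothesis lab_range : forall v, in_range N (lab v).
Hypothesis lab_surj : forall a k, 0 < k -> k <= N -> exists v, lab v = (a, k).

Lemma claw_swap t s m n (S S' K : {set T}) : valid N m n ->
  (forall u v, u \in K -> v \in S :|: S' -> lrel lab u v -> v \in K) ->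
  claw_at lab t s m n S S' ->
  claw_at lab t s m n (swap_on K (S, S')).1 (swap_on K (S, S')).2 ||
  claw_at lab t s m n (swap_on K (S, S')).2 (swap_on K (S, S')).1.
Proof.
move=> vmn Kc /claw_atP[HC HL].
have hC a k : 0 < k -> k <= N -> win 1 m n k -> has_label lab S (a, k) = centre t m n (a, k).
  by move=> k0 kN W; have [v lv] := lab_surj a k0 kN; rewrite -lv has_label_lab // HC // lv.
have hL a k : 0 < k -> k <= N -> win 2 m n k -> has_label lab S' (a, k) = leaf t s m n (a, k).
  by move=> k0 kN W; have [v lv] := lab_surj a k0 kN; rewrite -lv has_label_lab // HL // lv.
have hK x y : has_label lab S x || has_label lab S' x ->
    has_label lab S y || has_label lab S' y -> ladj x y ->
    has_label lab K x = has_label lab K y.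
  have mem z : has_label lab S z || has_label lab S' z -> exists2 u, u \in S :|: S' & lab u = z.
    by case/orP=> /has_labelP[u uS <-]; exists u => //; rewrite inE uS ?orbT.
  move=> /mem[u uS <-] /mem[v vS <-] uv; rewrite !has_label_lab //.
  by apply/idP/idP => H; [apply: Kc H _ _ | apply: Kc H _ _; rewrite // /lrel ladjC].
(* Near the tree, [K] contains all vertices of the pair or none, so the swap there either exchanges
   the two sides or changes nothing. *)
have [kap kapP] : exists kap, forall v, v \in S :|: S' -> win 2 m n (lab v).2 -> (v \in K) = kap.
  eexists => v vS W; rewrite -(has_label_lab lab_inj).
  apply: (claw_const vmn hC hL hK) => //.
  by move: vS; rewrite inE !has_label_lab.
have w12 k : win 1 m n k -> win 2 m n k by rewrite /win; clear; lia.
have key v : win 2 m n (lab v).2 ->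
    (v \in (swap_on K (S, S')).1) = (v \in if kap then S' else S) /\
    (v \in (swap_on K (S, S')).2) = (v \in if kap then S else S').
  move=> W; have := kapP v; rewrite /swap_on /=; case: (kap); rewrite !inE W;
  case: (v \in S); case: (v \in S') => /= H; try rewrite (H isT isT) /=; by case: (v \in K).
case: kap kapP key => _ key; apply/orP; [right|left]; apply/claw_atP; split=> v W.
- by rewrite (key v (w12 _ W)).2 HC.
- by rewrite (key v W).1 HL.
- by rewrite (key v (w12 _ W)).1 HC.
- by rewrite (key v W).2 HL.
Qed.

End ClawSwap.

(** * The relation attached to a claw chain *)

Section ChainRelation.
Local Open Scope ring_scope.
Variables (R : nzRingType) (T : finType) (lab : T -> label) (N : nat) (g : T -> R).
Hypothesis lab_inj : injective lab.
Hypothesis lab_surj : forall a k, (0 < k)%N -> (k <= N)%N -> exists v, lab v = (a, k).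
Hypothesis gC : forall u v, g u * g v = (-1) ^+ lrel lab u v * (g v * g u).

Definition labset (P : pred label) : {set T} := [set v | P (lab v)].

Definition lmon (P : pred label) : R := mon g (labset P).

Definition lgen (x : label) : R := lmon (pred1 x).

Lemma labset_stable (P : pred label) :
  (forall x y, P x -> P y -> ladj x y = false) -> stable (lrel lab) (labset P).
Proof.
by move=> H; apply/stableP => u v; rewrite !inE => Pu Pv; rewrite /lrel H.
Qed.

Lemma lmon_split (P P1 P2 : pred label) :
  (forall x y, P x -> P y -> ladj x y = false) ->
  (forall x, P x = P1 x || P2 x) -> (forall x, P1 x -> P2 x = false) ->
  lmon P = lmon P1 * lmon P2.
Proof.
move=> st PE dj; have E : labset P = labset P1 :|: labset P2.
  by apply/setP => v; rewrite !inE PE.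
rewrite /lmon E (mon_setU gC) -?E ?labset_stable //.
by rewrite disjoints_subset; apply/subsetP => v; rewrite !inE => /dj ->.
Qed.

Lemma lmon_comm (P P' : pred label) : (forall x y, P x -> P' y -> ladj x y = false) ->
  lmon P * lmon P' = lmon P' * lmon P.
Proof.
move=> H; rewrite /lmon (monC gC) /edges big1 ?mul1r // => u; rewrite inE => Pu.
by rewrite big1 // => v; rewrite inE => Pv; rewrite /lrel H.
Qed.

Lemma lgenE v : lgen (lab v) = g v.
Proof.
rewrite /lgen /lmon (_ : labset _ = [set v]) ?mon1 //.
by apply/setP => u; rewrite !inE (inj_eq lab_inj).
Qed.

Lemma lgen_anti a k b l : (0 < k <= N)%N -> (0 < l <= N)%N -> ladj (a, k) (b, l) ->
  lgen (a, k) * lgen (b, l) = - (lgen (b, l) * lgen (a, k)).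
Proof.
move=> /andP[k0 kN] /andP[l0 lN] adj.
have [u lu] := lab_surj a k0 kN; have [v lv] := lab_surj b l0 lN.
by rewrite -lu -lv !lgenE gC /lrel lu lv adj mulN1r.
Qed.

Definition steps (a : option bool) (lo hi : nat) : pred label :=
  fun x => [&& x.1 == a, lo <= x.2, x.2 <= hi & ~~ odd (x.2 + lo)]%N.

Lemma steps_last a lo hi : (lo <= hi.+2)%N -> ~~ odd (lo + hi) ->
  lmon (steps a lo hi.+2) = lmon (steps a lo hi) * lgen (a, hi.+2).
Proof.
move=> le od; apply: lmon_split.
- move=> [b i] [c j] /=; rewrite /steps /= => /and4P[/eqP-> i1 i2 i3] /and4P[/eqP-> j1 j2 j3].
  by case: a => [[]|] /=; clear -i1 i2 i3 j1 j2 j3; lia.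
- move=> [b i]; rewrite /steps /= xpair_eqE; case: (b == a) => //=; clear -le od; lia.
- move=> [b i] /and4P[_ _ /= ihi _]; rewrite xpair_eqE.
  by apply/negbTE; rewrite negb_and; apply/orP; right; clear -ihi; lia.
Qed.

(** The element [A_(2k-1)] of the hypothesis, while [lgen (KO, k.-1) * lgen (KB, k.+1)] is
    [C_(2k)]. *)
Definition bracket (k : nat) : R :=
  lgen (KE, k) * lgen (KO, k.-1) + lgen (KE, k.-1) * lgen (KB, k).

Hypothesis bracket_rel : forall k, (1 < k)%N -> (k.+2 <= N)%N ->
  bracket k * (lgen (KO, k) * lgen (KB, k.+2)) =
  lgen (KO, k.-1) * lgen (KB, k.+1) * bracket k.+2.

Lemma steps_single a k : lmon (steps a k k) = lgen (a, k).
Proof.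
rewrite /lgen /lmon; congr (mon g _); apply/setP => v; rewrite !inE.
case: (lab v) => b i; rewrite /steps /= xpair_eqE; case: (b == a) => //=; clear; lia.
Qed.

Lemma steps_comm x a lo hi :
  (forall k, (lo <= k)%N -> (k <= hi)%N -> ladj x (a, k) = false) ->
  lgen x * lmon (steps a lo hi) = lmon (steps a lo hi) * lgen x.
Proof.
move=> H; apply: lmon_comm => _ [b k] /eqP-> /and4P[/eqP /= -> k1 k2 _]; exact: H.
Qed.

Lemma lgen_comm x y : ladj x y = false -> lgen x * lgen y = lgen y * lgen x.
Proof. by move=> H; apply: lmon_comm => _ _ /eqP-> /eqP->. Qed.

Lemma bracket_comm x k :
  (forall y, y \in [:: (KE, k); (KO, k.-1); (KE, k.-1); (KB, k)] -> ladj x y = false) ->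
  lgen x * bracket k = bracket k * lgen x.
Proof.
move=> H; have c y : y \in [:: (KE, k); (KO, k.-1); (KE, k.-1); (KB, k)] ->
  lgen x * lgen y = lgen y * lgen x by move/H; exact: lgen_comm.
rewrite /bracket mulrDr mulrDl !mulrA.
rewrite (c (KE, k)) ?(c (KE, k.-1)) ?inE ?eqxx ?orbT // -!mulrA.
by rewrite (c (KO, k.-1)) ?(c (KB, k)) ?inE ?eqxx ?orbT.
Qed.

(** Each term of the bracket is a product of two generators, so the two signs cancel. *)
Lemma bracket_anti x k : (0 < x.2 <= N)%N -> (1 < k <= N)%N ->
  (forall y, y \in [:: (KE, k); (KO, k.-1); (KE, k.-1); (KB, k)] -> ladj x y) ->
  lgen x * bracket k = bracket k * lgen x.
Proof.
move=> xN kN H.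
have a y : y \in [:: (KE, k); (KO, k.-1); (KE, k.-1); (KB, k)] ->
    lgen x * lgen y = - (lgen y * lgen x).
  move=> yin; have := H _ yin; case: x xN {H} => a i xN; case: y yin => b j yin.
  apply: lgen_anti => //=.
  by move: yin; rewrite !inE => /or4P[] /eqP[_ ->]; clear -kN; lia.
rewrite /bracket mulrDr mulrDl !mulrA.
rewrite (a (KE, k)) ?(a (KE, k.-1)) ?inE ?eqxx ?orbT // !mulNr -!mulrA.
by rewrite (a (KO, k.-1)) ?(a (KB, k)) ?inE ?eqxx ?orbT // !mulrN !opprK.
Qed.

(* The identity [A_m C_(m+1) ... C_(n+1) = C_m ... C_n A_(n+2)] with the centres moved to
   the left, which costs one sign. *)
Lemma chain_rel m r : (1 < m)%N -> ((m + r.*2).+2 <= N)%N ->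
  lmon (steps KO m (m + r.*2)) * bracket m * lmon (steps KB m.+2 (m + r.*2).+2) +
  lmon (steps KB m.+1 (m + r.*2).+1) *
    (lmon (steps KO m.-1 (m + r.*2).-1) * bracket (m + r.*2).+2) = 0.
Proof.
move=> m1; elim: r => [|r IH] nN.
  rewrite double0 addn0 in nN *; rewrite !steps_single bracket_anti /=; last first.
  - by move=> y; rewrite !inE => /or4P[] /eqP-> /=; clear -m1; lia.
  - by clear -m1 nN; lia.
  - by clear -m1 nN; lia.
  rewrite -mulrA bracket_rel // mulrA -mulrDl lgen_anti ?addNr ?mul0r //=;
    by clear -m1 nN; lia.
rewrite doubleS !addnS in nN *; set n := (m + r.*2)%N in IH nN *.
have mn : (m <= n)%N by rewrite leq_addr.
have odn : ~~ odd (m + n) by rewrite /n; clear; lia.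
have {}IH := IH ltac:(by clear -nN; lia).
rewrite [lmon (steps KO m n.+2)]steps_last //; last by clear -mn; lia.
rewrite [lmon (steps KB m.+2 n.+4)]steps_last //; last 2 first.
- by clear -mn; lia.
- by clear -odn; lia.
rewrite [lmon (steps KB m.+1 n.+3)]steps_last //; last 2 first.
- by clear -mn; lia.
- by clear -odn; lia.
have -> : lmon (steps KO m.-1 n.+2.-1) = lmon (steps KO m.-1 n.-1) * lgen (KO, n.+1).
  rewrite (_ : n.+2.-1 = n.-1.+2); last by clear -m1 mn; lia.
  rewrite steps_last //; [|by clear -mn; lia|by clear -m1 mn odn; lia].
  by rewrite (_ : n.-1.+2 = n.+1) //; clear -m1 mn; lia.
have oB : lgen (KO, n.+2) * lmon (steps KB m.+2 n.+2) =
          - (lmon (steps KB m.+2 n.+2) * lgen (KO, n.+2)).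
  rewrite steps_last; [|by clear -mn; lia|by clear -odn; lia].
  by rewrite mulrA steps_comm -?mulrA 1?lgen_anti ?mulrN //=; clear -nN; lia.
have oA : lgen (KO, n.+2) * bracket m = bracket m * lgen (KO, n.+2).
  apply: bracket_comm => y; rewrite !inE => /or4P[] /eqP-> /=; clear -m1 mn; lia.
have bO : lgen (KB, n.+3) * lmon (steps KO m.-1 n.-1) = lmon (steps KO m.-1 n.-1) * lgen (KB, n.+3).
  by apply: steps_comm => k /=; clear -m1 mn; lia.
have bo : lgen (KB, n.+3) * lgen (KO, n.+1) = - (lgen (KO, n.+1) * lgen (KB, n.+3)).
  by apply: lgen_anti => /=; clear -nN; lia.
have rel := bracket_rel (k := n.+2) ltac:(by []) nN.
set X := lmon (steps KO m n) in IH *; set Y := lmon (steps KB m.+2 n.+2) in IH oB *.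
set U := lmon (steps KB m.+1 n.+1) in IH *; set V := lmon (steps KO m.-1 n.-1) in IH bO *.
(* Each summand for [r+1] is minus the summand for [r] times [O_(n+2) B_(n+4)]. The sign comes from
   one anticommuting pair, [O_(n+2)] with [B_(n+2)] in the first summand and [B_(n+3)] with
   [O_(n+1)] in the second. *)
have -> : X * lgen (KO, n.+2) * bracket m * (Y * lgen (KB, n.+4)) =
   - (X * bracket m * Y * (lgen (KO, n.+2) * lgen (KB, n.+4))).
  by rewrite -!mulrA (mulrA _ (bracket m)) oA -!mulrA (mulrA _ Y) oB !mulNr !mulrN !mulrA.
have -> : U * lgen (KB, n.+3) * (V * lgen (KO, n.+1) * bracket n.+4) =
   - (U * (V * bracket n.+2) * (lgen (KO, n.+2) * lgen (KB, n.+4))).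
  rewrite -!mulrA rel !mulrA -[U * _ * V]mulrA bO !mulrA -[_ * _ * lgen (KO, n.+1)]mulrA bo.
  by rewrite !mulrN !mulNr !mulrA.
by rewrite -opprD -mulrDl IH mul0r oppr0.
Qed.

Lemma eq_lmon (P P' : pred label) : (forall x, P x = P' x) -> lmon P = lmon P'.
Proof. by move=> H; rewrite /lmon; congr (mon g _); apply/setP => v; rewrite !inE H. Qed.

Lemma leaf_stable t s m n x y : (0 < m)%N -> (m <= n)%N -> ~~ odd (m + n) ->
  leaf t s m n x -> leaf t s m n y -> ladj x y = false.
Proof.
case: x y => a i [b j] m0 mn od.
by case: t; case: s; case: a => [[]|]; case: b => [[]|] //=; clear -m0 mn od; lia.
Qed.

Lemma leaf_split t s m n (x y : label) a lo hi : (0 < m)%N -> (m <= n)%N -> ~~ odd (m + n) ->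
  (forall z, leaf t s m n z = (z == x) || ((z == y) || steps a lo hi z)) ->
  x != y -> (forall z, steps a lo hi z -> (z != x) && (z != y)) ->
  lmon (leaf t s m n) = lgen x * lgen y * lmon (steps a lo hi).
Proof.
move=> m0 mn od LE xy dj; have st := leaf_stable m0 mn od.
have yz z : (z == y) || steps a lo hi z -> leaf t s m n z by rewrite LE => ->; rewrite orbT.
rewrite (@lmon_split _ (pred1 x) (fun z => (z == y) || steps a lo hi z)) //; last 2 first.
- by move=> u v; apply: st.
- move=> z /eqP->; rewrite (negbTE xy) /=.
  by apply/negP => /dj; rewrite eqxx.
rewrite (@lmon_split (fun z => (z == y) || steps a lo hi z) (pred1 y) (steps a lo hi)) ?mulrA //.
  by move=> u v /yz lu /yz lv; apply: st lu lv.
by move=> z /eqP->; apply/negP => /dj; rewrite eqxx andbF.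
Qed.

Lemma claw_rel m n : valid N m n ->
  lmon (centre true m n) * (lmon (leaf true true m n) + lmon (leaf true false m n)) +
  lmon (centre false m n) * (lmon (leaf false true m n) + lmon (leaf false false m n)) = 0.
Proof.
case/and4P => m1 mn od nN; have m0 := ltnW m1.
have C1 : lmon (centre true m n) = lmon (steps KO m n).
  by apply: eq_lmon => -[[[]|] k]; rewrite /steps.
have C2 : lmon (centre false m n) = lmon (steps KB m.+1 n.+1).
  by apply: eq_lmon => -[[[]|] k]; rewrite /steps //= addnS /= negbK.
have L1 : lmon (leaf true true m n) =
    lgen (KE, m) * lgen (KO, m.-1) * lmon (steps KB m.+2 n.+2).
  apply: leaf_split => // -[[[]|] k]; rewrite /steps ?xpair_eqE //=; clear -m1 mn od; lia.
have L2 : lmon (leaf true false m n) =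
    lgen (KE, m.-1) * lgen (KB, m) * lmon (steps KB m.+2 n.+2).
  apply: leaf_split => // -[[[]|] k]; rewrite /steps ?xpair_eqE //=; clear -m1 mn od; lia.
have L3 : lmon (leaf false true m n) =
    lgen (KE, n.+2) * lgen (KO, n.+1) * lmon (steps KO m.-1 n.-1).
  apply: leaf_split => // -[[[]|] k]; rewrite /steps ?xpair_eqE //=; clear -m1 mn od; lia.
have L4 : lmon (leaf false false m n) =
    lgen (KE, n.+1) * lgen (KB, n.+2) * lmon (steps KO m.-1 n.-1).
  apply: leaf_split => // -[[[]|] k]; rewrite /steps ?xpair_eqE //=; clear -m1 mn od; lia.
have En : n = (m + ((n - m)./2).*2)%N by clear -mn od; lia.
have := @chain_rel m (n - m)./2 m1; rewrite -En => /(_ nN).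
rewrite C1 C2 L1 L2 L3 L4 -!mulrDl -/(bracket m) -/(bracket n.+2) => <-.
have c x y : (forall k, (m.-1 <= k)%N -> (k <= n.-1)%N -> ladj x (KO, k) = false) ->
    (forall k, (m.-1 <= k)%N -> (k <= n.-1)%N -> ladj y (KO, k) = false) ->
    lmon (steps KO m.-1 n.-1) * (lgen x * lgen y) =
    lgen x * lgen y * lmon (steps KO m.-1 n.-1).
  by move=> hx hy; rewrite mulrA -steps_comm // -!mulrA steps_comm.
congr (_ + _ * _); first by rewrite mulrA.
by rewrite /bracket mulrDl mulrDr !c // => k _; rewrite /=; clear -m1 mn; lia.
Qed.

End ChainRelation.

Section Reverse.
Local Open Scope ring_scope.
Variables (R : nzRingType) (T : finType) (lab : T -> label) (N : nat) (g : T -> R).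
Hypothesis lab_inj : injective lab.
Hypothesis lab_surj : forall a k, (0 < k)%N -> (k <= N)%N -> exists v, lab v = (a, k).
Hypothesis gC : forall u v, g u * g v = (-1) ^+ lrel lab u v * (g v * g u).

(* The mirror image of the relation is obtained in the converse ring. *)
Let gc : T -> R^c := g.

Lemma mon_converse S : stable (lrel lab) S -> mon gc S = mon g S.
Proof.
move=> /stableP st; rewrite /mon; elim: (index_enum T) => [|u r IH]; first by rewrite !big_nil.
rewrite !big_cons; case: ifP => // uS.
rewrite (prod_signC gC) [X in (-1) ^+ X]big1 ?mul1r -?IH // => v vS.
by rewrite (negbTE (st _ _ _ _)).
Qed.

Hypothesis bracket_rel : forall k, (1 < k)%N -> (k.+2 <= N)%N ->
  bracket lab g k * (lgen lab g (KO, k) * lgen lab g (KB, k.+2)) =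
  lgen lab g (KO, k.-1) * lgen lab g (KB, k.+1) * bracket lab g k.+2.

Local Notation lm := (lmon lab g).

(** Needed for the pairs whose centres lie in the second set. *)
Lemma claw_rel_rev m n : valid N m n ->
  (lm (leaf true true m n) + lm (leaf true false m n)) * lm (centre true m n) +
  (lm (leaf false true m n) + lm (leaf false false m n)) * lm (centre false m n) = 0.
Proof.
move=> vmn; have [m1 mn od nN] := and4P vmn; have m0 := ltnW m1.
have lE (P : pred label) : (forall x y, P x -> P y -> ladj x y = false) ->
    lmon lab gc P = lm P.
  by move=> H; apply: mon_converse; apply: labset_stable.
have gE x : lgen lab gc x = lgen lab g x.
  by apply: lE => _ _ /eqP-> /eqP->; rewrite ladjxx.
have LE t s : lmon lab gc (leaf t s m n) = lm (leaf t s m n).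
  by apply: lE => x y; apply: leaf_stable.
have CE t : lmon lab gc (centre t m n) = lm (centre t m n).
  apply: lE => -[a i] [b j]; case: t; case: a => [[]|]; case: b => [[]|] //=;
  clear -m1 mn od; lia.
have gcC u v : gc u * gc v = (-1) ^+ lrel lab u v * (gc v * gc u).
  change (g v * g u = g u * g v * ((-1) ^+ lrel lab u v : R^c)).
  have -> : ((-1) ^+ lrel lab u v : R^c) = ((-1) ^+ lrel lab u v : R) by case: (lrel lab u v).
  by rewrite commr_sign gC /lrel ladjC.
have gcomm x y : ladj x y = false -> lgen lab g x * lgen lab g y = lgen lab g y * lgen lab g x.
  exact: lgen_comm.
have bE k : (1 < k)%N -> bracket lab gc k = bracket lab g k.
  move=> k1; rewrite {1}/bracket !gE.
  change (lgen lab g (KO, k.-1) * lgen lab g (KE, k) + lgen lab g (KB, k) * lgen lab g (KE, k.-1)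
          = bracket lab g k).
  by rewrite /bracket [in RHS]gcomm ?[in RHS](gcomm (KE, k.-1)) //=; clear -k1; lia.
have rel := @claw_rel R^c T lab N gc lab_inj lab_surj gcC _ m n vmn.
rewrite -!LE -!CE; apply: rel => k k1 kN.
rewrite !bE ?gE //.
change (lgen lab g (KB, k.+2) * lgen lab g (KO, k) * bracket lab g k =
        bracket lab g k.+2 * (lgen lab g (KB, k.+1) * lgen lab g (KO, k.-1))).
have anti a i b j : (0 < i <= N)%N -> (0 < j <= N)%N -> ladj (a, i) (b, j) ->
  lgen lab g (a, i) * lgen lab g (b, j) = - (lgen lab g (b, j) * lgen lab g (a, i)).
  exact: lgen_anti.
(* Restoring the order inside each [C] costs one sign on either side; every generator of a [C] then
   commutes with the bracket it has to cross. *)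
rewrite (anti KB k.+2 KO k) 1?(anti KB k.+1 KO k.-1) /=; try (clear -k1 kN; lia).
rewrite mulNr mulrN; congr (- _).
have c1 : lgen lab g (KB, k.+2) * bracket lab g k = bracket lab g k * lgen lab g (KB, k.+2).
  by apply: bracket_comm => // y; rewrite !inE => /or4P[] /eqP-> /=; clear -k1; lia.
have c2 : lgen lab g (KO, k.-1) * bracket lab g k.+2 = bracket lab g k.+2 * lgen lab g (KO, k.-1).
  by apply: bracket_comm => // y; rewrite !inE => /or4P[] /eqP-> /=; clear -k1; lia.
have c3 : lgen lab g (KO, k) * bracket lab g k = bracket lab g k * lgen lab g (KO, k).
  apply: (bracket_anti (N := N)) => //=; try (clear -k1 kN; lia).
  by move=> y; rewrite !inE => /or4P[] /eqP-> /=; clear -k1; lia.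
have c4 : lgen lab g (KB, k.+1) * bracket lab g k.+2 = bracket lab g k.+2 * lgen lab g (KB, k.+1).
  apply: (bracket_anti (N := N)) => //=; try (clear -k1 kN; lia).
  by move=> y; rewrite !inE => /or4P[] /eqP-> /=; clear -k1; lia.
by rewrite -mulrA c1 mulrA c3 -mulrA bracket_rel // -mulrA c4 mulrA c2 mulrA.
Qed.

End Reverse.

(** * Exchanging the four patterns of a claw chain *)

Lemma centre_stable t m n x y : centre t m n x -> centre t m n y -> ladj x y = false.
Proof. by case: x y => a i [b j]; case: t; case: a => [[]|]; case: b => [[]|] //=; clear; lia. Qed.

Lemma centre_nbr t m n x y : 0 < m -> m <= n -> ~~ odd (m + n) -> centre t m n x -> ladj x y -> win 1 m n y.2.
Proof.
rewrite /win; case: x y => a i [b j] /=; case: t; case: a => [[]|] //=;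
by case: b => [[]|] /=; clear; lia.
Qed.

Lemma leaf_nbr t s m n x y : 0 < m -> m <= n -> ~~ odd (m + n) -> leaf t s m n x -> ladj x y -> win 2 m n y.2.
Proof.
rewrite /win; case: x y => a i [b j] /=; case: t; case: s; case: a => [[]|] //=;
by case: b => [[]|] /=; clear; lia.
Qed.

Section Exchange.
Variables (T : finType) (lab : T -> label) (N : nat).
Hypothesis lab_inj : injective lab.
Hypothesis lab_surj : forall a k, 0 < k -> k <= N -> exists v, lab v = (a, k).

Local Notation pair := ({set T} * {set T})%type.
Local Notation labset := (labset lab).

(** Overwriting the windows makes the map total, and a later exchange at the same [m] and [n]
    absorbs an earlier one. *)
Definition exchange (t s : bool) (m n : nat) (q : pair) : pair :=
  (q.1 :\: labset (fun x => win 1 m n x.2) :|: labset (centre t m n),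
   labset (leaf t s m n) :|: q.2 :\: labset (fun x => win 2 m n x.2)).

Lemma centre_win t m n x : m <= n -> centre t m n x -> win 1 m n x.2.
Proof. by move=> mn /centre_width; rewrite /win; clear -mn; lia. Qed.

Lemma leaf_win t s m n x : 0 < m -> m <= n -> leaf t s m n x -> win 2 m n x.2.
Proof. by move=> m0 mn /(leaf_width m0 mn); rewrite /win; clear -mn; lia. Qed.

Lemma claw_at_exchange t s m n q : 0 < m -> m <= n ->
  claw_at lab t s m n (exchange t s m n q).1 (exchange t s m n q).2.
Proof.
by move=> m0 mn; apply/claw_atP; split=> v W; rewrite !inE W /= ?andbF ?orbF.
Qed.

Lemma exchange_id t s m n q : 0 < m -> m <= n -> claw_at lab t s m n q.1 q.2 ->
  exchange t s m n q = q.
Proof.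
move=> m0 mn /claw_atP[HC HL]; case: q HC HL => C L /= HC HL.
congr (_, _); apply/setP => v; rewrite !inE.
  have [W|W] := boolP (win 1 m n (lab v).2); first by rewrite /= HC.
  by rewrite /= (contraNF (@centre_win _ _ _ _ mn) W) orbF.
have [W|W] := boolP (win 2 m n (lab v).2); first by rewrite /= HL ?orbF.
by rewrite /= (contraNF (@leaf_win _ _ _ _ _ m0 mn) W).
Qed.

Lemma exchange_exchange t0 s0 t s m n q : 0 < m -> m <= n ->
  exchange t0 s0 m n (exchange t s m n q) = exchange t0 s0 m n q.
Proof.
move=> m0 mn; congr (_, _); apply/setP => v; rewrite !inE.
  have [W|W] := boolP (win 1 m n (lab v).2) => //=.
  by rewrite !(contraNF (@centre_win _ _ _ _ mn) W) ?orbF.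
have [W|W] := boolP (win 2 m n (lab v).2) => //=.
by rewrite !(contraNF (@leaf_win _ _ _ _ _ m0 mn) W).
Qed.

Lemma exchange1E t0 s0 t s m n q v : 0 < m -> m <= n -> claw_at lab t0 s0 m n q.1 q.2 ->
  (lab v).2 < m \/ n.+1 < (lab v).2 -> (v \in (exchange t s m n q).1) = (v \in q.1).
Proof.
move=> m0 mn /claw_atP[HC _] out; rewrite !inE.
have cF t' : centre t' m n (lab v) = false.
  by apply/negP => /centre_width; clear -out; lia.
rewrite cF orbF; have [W|//] := boolP (win 1 m n (lab v).2).
by rewrite /= HC.
Qed.

Lemma exchange2E t0 s0 t s m n q v : 0 < m -> m <= n -> claw_at lab t0 s0 m n q.1 q.2 ->
  (lab v).2.+1 < m \/ n.+2 < (lab v).2 -> (v \in (exchange t s m n q).2) = (v \in q.2).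
Proof.
move=> m0 mn /claw_atP[_ HL] out; rewrite !inE.
have cF t' s' : leaf t' s' m n (lab v) = false.
  by apply/negP => /(leaf_width m0 mn); clear -out; lia.
rewrite cF orFb; have [W|//] := boolP (win 2 m n (lab v).2).
by rewrite /= HL.
Qed.

Lemma exchange_stable t s m n q : valid N m n -> stable (lrel lab) q.1 -> stable (lrel lab) q.2 ->
  stable (lrel lab) (exchange t s m n q).1 /\ stable (lrel lab) (exchange t s m n q).2.
Proof.
case/and4P=> m1 mn od _ /stableP st1 /stableP st2; have m0 := ltnW m1.
split; apply/stableP => u v; rewrite !inE.
- case/orP=> [/andP[uW uq]|uC] /orP[/andP[vW vq]|vC]; first exact: st1.
  + by apply: contra uW; rewrite /lrel ladjC; apply: centre_nbr vC.
  + by apply: contra vW; apply: centre_nbr uC.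
  + by rewrite /lrel (centre_stable uC vC).
- case/orP=> [uC|/andP[uW uq]] /orP[vC|/andP[vW vq]]; last exact: st2.
  + by rewrite /lrel (leaf_stable m0 mn od uC vC).
  + by apply: contra vW; apply: leaf_nbr uC.
  + by apply: contra uW; rewrite /lrel ladjC; apply: leaf_nbr vC.
Qed.

Lemma card_labsetU (P P1 P2 : pred label) :
  (forall x, P x = P1 x || P2 x) -> (forall x, P1 x -> P2 x = false) ->
  #|labset P| = #|labset P1| + #|labset P2|.
Proof.
move=> PE dj; rewrite -[RHS]subn0 -(cards0 T).
have <- : labset P1 :&: labset P2 = set0.
  by apply/setP => v; rewrite !inE; apply/negP => /andP[/dj ->].
by rewrite -cardsU; congr #|pred_of_set _|; apply/setP => v; rewrite !inE PE.
Qed.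

Lemma card_labset1 a k : 0 < k -> k <= N -> #|labset (pred1 (a, k))| = 1.
Proof.
move=> k0 kN; have [v lv] := lab_surj a k0 kN.
rewrite (_ : labset _ = [set v]) ?cards1 //.
by apply/setP => u; rewrite !inE -lv (inj_eq lab_inj).
Qed.

Lemma eq_card_labset (P P' : pred label) : (forall x, P x = P' x) -> #|labset P| = #|labset P'|.
Proof. by move=> H; congr #|pred_of_set _|; apply/setP => v; rewrite !inE H. Qed.

Lemma card_steps a lo r : 0 < lo -> lo + r.*2 <= N -> #|labset (steps a lo (lo + r.*2))| = r.+1.
Proof.
move=> lo0; elim: r => [|r IH] leN.
  rewrite addn0 in leN *; rewrite -(card_labset1 a lo0 leN); apply: eq_card_labset => -[b i].
  by rewrite /steps /= xpair_eqE; case: (b == a) => //=; clear; lia.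
rewrite (@card_labsetU _ (steps a lo (lo + r.*2)) (pred1 (a, (lo + r.*2).+2))).
- by rewrite IH ?card_labset1 ?addn1 //; clear -leN; lia.
- by move=> [b i]; rewrite /steps /= xpair_eqE; case: (b == a) => //=; clear; lia.
- move=> [b i] /and4P[_ _ /= ihi _]; rewrite /= xpair_eqE.
  by apply/negbTE; rewrite negb_and; apply/orP; right; clear -ihi; lia.
Qed.

Lemma card_centre t m n : valid N m n -> #|labset (centre t m n)| = (n - m)./2.+1.
Proof.
case/and4P=> m1 mn od nN; set r := (n - m)./2.
have En : n = m + r.*2 by rewrite /r; clear -mn od; lia.
case: t.
  rewrite -(@card_steps KO m); [|clear -m1; lia|clear -En nN; lia].
  by apply: eq_card_labset => -[[[]|] k]; rewrite /steps //= -En.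
rewrite -(@card_steps KB m.+1) //; [|clear -En nN; lia].
by apply: eq_card_labset => -[[[]|] k]; rewrite /steps //= addSn -En addnS /= negbK.
Qed.

Lemma card_leaf t s m n : valid N m n -> #|labset (leaf t s m n)| = (n - m)./2.+3.
Proof.
case/and4P=> m1 mn od nN; set r := (n - m)./2.
have En : n = m + r.*2 by rewrite /r; clear -mn od; lia.
pose x : label := if t then (KE, if s then m else m.-1) else (KE, if s then n.+2 else n.+1).
pose y : label := if t then (if s then (KO, m.-1) else (KB, m))
                  else (if s then (KO, n.+1) else (KB, n.+2)).
pose P := if t then steps KB m.+2 (m.+2 + r.*2) else steps KO m.-1 (m.-1 + r.*2).
have cP : #|labset P| = r.+1.
  by rewrite /P; case: (t); apply: card_steps; clear -m1 En nN; lia.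
have cx : #|labset (pred1 x)| = 1.
  by rewrite /x; case: (t); case: (s); apply: card_labset1; clear -m1 mn nN; lia.
have cy : #|labset (pred1 y)| = 1.
  by rewrite /y; case: (t); case: (s); apply: card_labset1; clear -m1 mn nN; lia.
rewrite (@card_labsetU _ (pred1 x) (fun z => (z == y) || P z)); last 2 first.
- rewrite /x /y /P => -[a k]; case: (t); case: (s); case: a => [[]|];
  rewrite /steps /= ?xpair_eqE /=; clear -m1 mn od En; lia.
- move=> z /eqP->; rewrite /x /y /P; case: (t); case: (s); rewrite /steps ?xpair_eqE //=.
rewrite (@card_labsetU (fun z => (z == y) || P z) (pred1 y) P) //; last first.
  move=> z /eqP->; rewrite /y /P; case: (t); case: (s); rewrite /steps //=; clear -m1 mn; lia.
by rewrite cx cy cP.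
Qed.

(** The numbers of centres and of leaves are the same for all four trees. *)
Lemma exchange_card t0 s0 t s m n q : valid N m n -> claw_at lab t0 s0 m n q.1 q.2 ->
  #|(exchange t s m n q).1| = #|q.1| /\ #|(exchange t s m n q).2| = #|q.2|.
Proof.
move=> vmn cl; have [m1 mn od nN] := and4P vmn; have m0 := ltnW m1.
have c t' s' : #|(exchange t' s' m n q).1| =
    #|q.1 :\: labset (fun x => win 1 m n x.2)| + (n - m)./2.+1.
  rewrite /exchange /= cardsU (_ : _ :&: labset (centre _ _ _) = set0) ?cards0 ?subn0 ?card_centre //.
  apply/setP => v; rewrite !inE; case W: (centre _ _ _ _); rewrite ?andbF //.
  by rewrite (centre_win mn W).
have c' t' s' : #|(exchange t' s' m n q).2| =
    (n - m)./2.+3 + #|q.2 :\: labset (fun x => win 2 m n x.2)|.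
  rewrite /exchange /= cardsU (_ : labset (leaf _ _ _ _) :&: _ = set0) ?cards0 ?subn0 ?card_leaf //.
  apply/setP => v; rewrite !inE; case W: (leaf _ _ _ _ _) => //.
  by rewrite (leaf_win m0 mn W).
by rewrite c c' -(c t0 s0) -(c' t0 s0) exchange_id.
Qed.

End Exchange.

(** * Cancellation of the pairs with a claw chain *)

Section ClawSum.
Variables (T : finType) (lab : T -> label) (N : nat).
Hypothesis lab_inj : injective lab.
Hypothesis lab_surj : forall a k, 0 < k -> k <= N -> exists v, lab v = (a, k).

Local Notation pair := ({set T} * {set T})%type.

Definition orient (o : bool) (p : pair) : pair := if o then p else (p.2, p.1).

Lemma orientK o : involutive (orient o).
Proof. by case: o => -[]. Qed.

Definition claw_of (m n : nat) (q : pair) := [exists ts : bool * bool, claw_at lab ts.1 ts.2 m n q.1 q.2].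

Lemma claw_ofP m n q : reflect (exists t s, claw_at lab t s m n q.1 q.2) (claw_of m n q).
Proof.
apply: (iffP existsP) => [[[t s] H]|[t [s H]]]; first by exists t, s.
by exists (t, s).
Qed.

(** The boolean gives the side of the centres. The pattern [(t, s)] is left out so that exchanges
    preserve the place. *)
Definition place : finType := ('I_N.+1 * 'I_N.+1 * bool)%type.

Definition claws (p : pair) : pred place := fun x =>
  valid N x.1.1 x.1.2 && claw_of x.1.1 x.1.2 (orient x.2 p).

Lemma same_claw t s m n t' s' m' n' (q : pair) : valid N m n -> valid N m' n' ->
  claw_at lab t s m n q.1 q.2 -> claw_at lab t' s' m' n' q.1 q.2 ->
  [\/ m = m' /\ n = n', n' + 5 <= m | n + 5 <= m'].
Proof.
move=> v v' /claw_atP[HC HL] /claw_atP[HC' HL'].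
have cE a k : 0 < k -> k <= N -> win 1 m n k -> win 1 m' n' k ->
    centre t m n (a, k) = centre t' m' n' (a, k).
  by move=> k0 kN W W'; have [u lu] := lab_surj a k0 kN; rewrite -lu -HC ?HC' ?lu.
have lE a k : 0 < k -> k <= N -> win 2 m n k -> win 2 m' n' k ->
    leaf t s m n (a, k) = leaf t' s' m' n' (a, k).
  by move=> k0 kN W W'; have [u lu] := lab_surj a k0 kN; rewrite -lu -HL ?HL' ?lu.
case: (ltngtP m m') => mm.
- by constructor 3; apply: (same_side_sep v' v _ _ mm) => a k k0 kN W W'; symmetry; [apply: cE | apply: lE].
- by constructor 2; apply: (same_side_sep v v' cE lE mm).
rewrite -{}mm in v' HC' HL' cE lE *; constructor 1; split=> //.
case: (leqP n' n) => [nn|/ltnW nn]; first by rewrite (same_start v v' cE lE nn).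
by apply: (same_start v' v _ _ nn) => a k k0 kN W W'; symmetry; [apply: cE | apply: lE].
Qed.

Lemma opposite_claw t s m n t' s' m' n' (q : pair) : valid N m n -> valid N m' n' ->
  claw_at lab t s m n q.1 q.2 -> claw_at lab t' s' m' n' q.2 q.1 ->
  n' + 4 <= m \/ n + 4 <= m'.
Proof.
move=> v v' /claw_atP[HC HL] /claw_atP[HC' HL'].
have cE a k : 0 < k -> k <= N -> win 1 m n k -> win 2 m' n' k ->
    centre t m n (a, k) = leaf t' s' m' n' (a, k).
  by move=> k0 kN W W'; have [u lu] := lab_surj a k0 kN; rewrite -lu -HC ?HL' ?lu.
have lE a k : 0 < k -> k <= N -> win 2 m n k -> win 1 m' n' k ->
    leaf t s m n (a, k) = centre t' m' n' (a, k).
  by move=> k0 kN W W'; have [u lu] := lab_surj a k0 kN; rewrite -lu -HL ?HC' ?lu.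
case: (leqP m' m) => [mm|/ltnW mm]; first by left; apply: (opposite_sep v v' cE lE mm).
by right; apply: (opposite_sep v' v _ _ mm) => a k k0 kN W W'; symmetry; [apply: lE | apply: cE].
Qed.

Lemma claw_unique t s t' s' m n (q : pair) : valid N m n ->
  claw_at lab t s m n q.1 q.2 -> claw_at lab t' s' m n q.1 q.2 -> t = t' /\ s = s'.
Proof.
case/and4P=> m1 mn od nN /claw_atP[HC HL] /claw_atP[HC' HL'].
have Et : t = t'.
  have [|| v lv] := lab_surj KO (k := m); try (clear -m1 mn nN; lia).
  have W : win 1 m n (lab v).2 by rewrite lv /win /=; clear -m1 mn nN; lia.
  have := HC v W; rewrite HC' // lv /= addnn odd_double mn leqnn /=.
  by case: (t); case: (t').
split=> //; rewrite -{}Et in HC' HL'.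
pose k := if t then m else n.+2.
have [|| v lv] := lab_surj KE (k := k); try (rewrite /k; case: (t); clear -m1 mn nN; lia).
have W : win 2 m n (lab v).2 by rewrite lv /win /k; case: (t) => /=; clear -m1 mn nN; lia.
have := HL v W; rewrite HL' // lv /k; case: (t); case: (s); case: (s') => //=; clear -m1; lia.
Qed.

(** Another isolated tree is so far away that its windows miss all columns changed by the
    exchange. *)
Lemma claws_exchange t0 s0 t s m n o q x : valid N m n ->
  claw_at lab t0 s0 m n q.1 q.2 -> claws (orient o q) x ->
  claws (orient o (exchange lab t s m n q)) x.
Proof.
move=> vmn cl; have [m1 mn od nN] := and4P vmn; have m0 := ltnW m1.
case: x => -[m' n'] o'; rewrite /claws /= => /andP[v' cl'].
rewrite v' /=; have [m1' mn' od' nN'] := and4P v'.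
have [Eo|No] := eqVneq o o'.
  rewrite -Eo in cl' *; rewrite !orientK in cl' *; case/claw_ofP: cl' => t' [s' cl'].
  apply/claw_ofP; have [[<- <-]|sep|sep] := same_claw vmn v' cl cl'.
  - by exists t, s; apply: claw_at_exchange.
  - exists t', s'; have /claw_atP[HC HL] := cl'; apply/claw_atP; split=> v W.
      rewrite (exchange1E t s m0 mn cl) ?HC //; move: W; rewrite /win.
      by clear -sep mn mn'; lia.
    rewrite (exchange2E t s m0 mn cl) ?HL //; move: W; rewrite /win.
    by clear -sep mn mn'; lia.
  - exists t', s'; have /claw_atP[HC HL] := cl'; apply/claw_atP; split=> v W.
      rewrite (exchange1E t s m0 mn cl) ?HC //; move: W; rewrite /win.
      by clear -sep mn mn'; lia.
    rewrite (exchange2E t s m0 mn cl) ?HL //; move: W; rewrite /win.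
    by clear -sep mn mn'; lia.
have oo (p : pair) : orient o' (orient o p) = (p.2, p.1).
  by move: No; case: (o); case: (o') => //; case: p.
rewrite !oo in cl' *; case/claw_ofP: cl' => t' [s' /= cl'].
apply/claw_ofP; exists t', s' => /=; have /claw_atP[HC HL] := cl'.
have sep := opposite_claw vmn v' cl cl'; apply/claw_atP; split=> v W.
  rewrite (exchange2E t s m0 mn cl) ?HC //; move: W; rewrite /win.
  by clear -sep mn mn'; lia.
rewrite (exchange1E t s m0 mn cl) ?HL //; move: W; rewrite /win.
by clear -sep mn mn'; lia.
Qed.

Lemma claws_exchangeE t0 s0 t s m n o q : valid N m n ->
  claw_at lab t0 s0 m n q.1 q.2 ->
  claws (orient o (exchange lab t s m n q)) =1 claws (orient o q).
Proof.
move=> vmn cl x; have [m1 mn _ _] := and4P vmn; have m0 := ltnW m1.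
apply/idP/idP; last exact: (claws_exchange _ _ vmn cl).
rewrite -{2}(exchange_id m0 mn cl) -(exchange_exchange lab t0 s0 t s q m0 mn).
by apply: claws_exchange => //; apply: claw_at_exchange.
Qed.

Section Sum.
Variables (R : nzRingType) (g : T -> R).
Local Open Scope ring_scope.
Hypothesis gC : forall u v, g u * g v = (-1) ^+ lrel lab u v * (g v * g u).
Hypothesis rel : forall m n, valid N m n ->
  lmon lab g (centre true m n) * (lmon lab g (leaf true true m n) + lmon lab g (leaf true false m n)) +
  lmon lab g (centre false m n) * (lmon lab g (leaf false true m n) + lmon lab g (leaf false false m n)) = 0.
Hypothesis rel_rev : forall m n, valid N m n ->
  (lmon lab g (leaf true true m n) + lmon lab g (leaf true false m n)) * lmon lab g (centre true m n) +
  (lmon lab g (leaf false true m n) + lmon lab g (leaf false false m n)) * lmon lab g (centre false m n) = 0.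

Let F (p : pair) := mon g p.1 * mon g p.2.

(** The parts outside the windows factor out on the two ends, leaving the relation of the four
    trees, in the order dictated by [o]. *)
Lemma sum_exchange m n o (q : pair) : valid N m n -> stable (lrel lab) q.1 -> stable (lrel lab) q.2 ->
  \sum_(ts : bool * bool) F (orient o (exchange lab ts.1 ts.2 m n q)) = 0.
Proof.
move=> vmn st1 st2; have [m1 mn od nN] := and4P vmn; have m0 := ltnW m1.
set X := mon g (q.1 :\: labset lab (fun x => win 1 m n x.2)).
set Y := mon g (q.2 :\: labset lab (fun x => win 2 m n x.2)).
have d1 t : [disjoint q.1 :\: labset lab (fun x => win 1 m n x.2) & labset lab (centre t m n)].
  rewrite disjoints_subset; apply/subsetP => v; rewrite !inE => /andP[W _].
  exact: contra (@centre_win _ _ _ _ mn) W.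
have d2 t s : [disjoint labset lab (leaf t s m n) & q.2 :\: labset lab (fun x => win 2 m n x.2)].
  rewrite disjoints_subset; apply/subsetP => v; rewrite !inE => L.
  by rewrite (leaf_win m0 mn L).
have s1 t := (exchange_stable t true vmn st1 st2).1.
have s2 t s := (exchange_stable t s vmn st1 st2).2.
rewrite /exchange /= in s1 s2.
have E1 t s : mon g (exchange lab t s m n q).1 = X * lmon lab g (centre t m n).
  by rewrite /= (mon_setU gC (s1 t) (d1 t)).
have E2 t s : mon g (exchange lab t s m n q).2 = lmon lab g (leaf t s m n) * Y.
  by rewrite /= (mon_setU gC (s2 t s) (d2 t s)).
have E1' t s : mon g (exchange lab t s m n q).1 = lmon lab g (centre t m n) * X.
  have := s1 t; have := d1 t; rewrite disjoint_sym => d; rewrite setUC => st.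
  by rewrite /= setUC (mon_setU gC st d).
have E2' t s : mon g (exchange lab t s m n q).2 = Y * lmon lab g (leaf t s m n).
  have := s2 t s; have := d2 t s; rewrite disjoint_sym => d; rewrite setUC => st.
  by rewrite /= setUC (mon_setU gC st d).
transitivity (\sum_t \sum_s F (orient o (exchange lab t s m n q))).
  by rewrite pair_bigA.
rewrite !big_bool /F; case: o; rewrite /orient.
  rewrite !E1 !E2; transitivity (X * (lmon lab g (centre true m n) *
    (lmon lab g (leaf true true m n) + lmon lab g (leaf true false m n)) +
    lmon lab g (centre false m n) *
    (lmon lab g (leaf false true m n) + lmon lab g (leaf false false m n))) * Y).
    by rewrite !mulrDr !mulrDl !mulrA.
  by rewrite rel // mulr0 mul0r.
rewrite !E1' !E2'; transitivity (Y * ((lmon lab g (leaf true true m n) +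
    lmon lab g (leaf true false m n)) * lmon lab g (centre true m n) +
    (lmon lab g (leaf false true m n) + lmon lab g (leaf false false m n)) *
    lmon lab g (centre false m n)) * X).
  by rewrite !(mulrDl, mulrDr) !mulrA.
by rewrite rel_rev // mulr0 mul0r.
Qed.

(** Exactly one pattern fits each pair. Exchanging reindexes the sum of each pattern by the pairs of
    pattern [(true, true)], so the total is a sum of the quadruples of [sum_exchange]. *)
Lemma sum_place (P : pred pair) (x : place) :
  (forall p, P p -> [/\ stable (lrel lab) p.1, stable (lrel lab) p.2 & claws p x]) ->
  (forall t0 s0 t s q, claw_at lab t0 s0 x.1.1 x.1.2 q.1 q.2 ->
     P (orient x.2 q) -> P (orient x.2 (exchange lab t s x.1.1 x.1.2 q))) ->
  \sum_(p | P p) F p = 0.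
Proof.
move=> Pst Pex; set m : nat := x.1.1 in Pex *; set n : nat := x.1.2 in Pex *; set o := x.2 in Pex *.
case vmn : (valid N m n); last first.
  by rewrite big_pred0 // => p; apply/negP => /Pst[_ _]; rewrite /claws vmn.
have [m1 mn od nN] := and4P vmn; have m0 := ltnW m1.
rewrite (reindex_inj (inv_inj (orientK o))) /=.
pose cl (ts : bool * bool) (q : pair) := claw_at lab ts.1 ts.2 m n q.1 q.2.
transitivity (\sum_(q | P (orient o q)) \sum_(ts | cl ts q) F (orient o q)).
  apply: eq_bigr => q /Pst[_ _ /andP[_]]; rewrite orientK => /existsP[ts cts].
  rewrite (big_pred1 ts) // => ts' /=; apply/idP/eqP => [cts'|-> //].
  by case: ts ts' cts cts' => t s [t' s'] c1 c2; have [/= -> ->] := claw_unique vmn c2 c1.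
rewrite (exchange_big_dep predT) //=.
transitivity (\sum_(ts : bool * bool) \sum_(q | P (orient o q) && cl (true, true) q)
    F (orient o (exchange lab ts.1 ts.2 m n q))).
  apply: eq_bigr => -[t s] _.
  rewrite (reindex_onto (exchange lab t s m n) (exchange lab true true m n)) /=; last first.
    move=> q /andP[_ c1]; rewrite exchange_exchange //; exact: exchange_id.
  apply: eq_bigl => q; rewrite exchange_exchange // [cl _ _]claw_at_exchange // andbT.
  apply/andP/andP => -[H1 H2].
    have c1 : cl (true, true) q by rewrite -(eqP H2); apply: claw_at_exchange.
    split=> //; rewrite -(eqP H2) -(exchange_exchange lab true true t s) //.
    by apply: (Pex t s) H1; apply: claw_at_exchange.
  by split; [apply: Pex H2 H1 | rewrite exchange_id].
rewrite exchange_big big1 //= => q /andP[/Pst[s1 s2 _] _].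
by apply: sum_exchange => //; move: s1 s2; case: (o).
Qed.

Lemma sum_claws (Q : pred pair) :
  (forall p, Q p -> stable (lrel lab) p.1 /\ stable (lrel lab) p.2) ->
  (forall o t0 s0 t s m n q, valid N m n -> claw_at lab t0 s0 m n q.1 q.2 ->
     Q (orient o q) -> Q (orient o (exchange lab t s m n q))) ->
  \sum_(p | Q p && [exists x, claws p x]) F p = 0.
Proof.
move=> Qst Qex.
(* A pair may contain several isolated trees. The one picked depends only on the predicate
   [claws p], which exchanges leave unchanged. *)
rewrite (partition_big (fun p => [pick x | claws p x]) (fun o => o != None)) /=; last first.
  move=> p /andP[_ /existsP[x cx]]; case: pickP => // none.
  by rewrite none in cx.
rewrite big1 // => -[x|//] _; apply: (sum_place (x := x)).
  by move=> p /andP[/andP[/Qst[s1 s2] _]]; case: pickP => [y cy /eqP[<-]|_ /eqP].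
move=> t0 s0 t s q cl /andP[/andP[Qq cq]] pk.
have cx : claws (orient x.2 q) x.
  by move: pk; case: pickP => [y + /eqP[Ey]|_ /eqP] //; rewrite Ey.
have [vx _] := andP cx.
have E := claws_exchangeE t s x.2 vx cl.
rewrite (Qex _ _ _ _ _ _ _ _ vx cl Qq) /=; apply/andP; split.
  by apply/existsP; exists x; rewrite E.
by rewrite (eq_pick E).
Qed.

End Sum.
End ClawSum.

(** * Commutation *)

Local Open Scope ring_scope.

Section Commutation.
Variables (R : nzRingType) (T : finType) (lab : T -> label) (N : nat) (g : T -> R).
Hypothesis lab_inj : injective lab.
Hypothesis lab_range : forall v, in_range N (lab v).
Hypothesis lab_surj : forall a k, (0 < k)%N -> (k <= N)%N -> exists v, lab v = (a, k).
Hypothesis gC : forall u v, g u * g v = (-1) ^+ lrel lab u v * (g v * g u).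
Hypothesis bracket_rel : forall k, (1 < k)%N -> (k.+2 <= N)%N ->
  bracket lab g k * (lgen lab g (KO, k) * lgen lab g (KB, k.+2)) =
  lgen lab g (KO, k.-1) * lgen lab g (KB, k.+1) * bracket lab g k.+2.
Hypothesis oppr_fix : forall x : R, x = - x -> x = 0.

Local Notation pair := ({set T} * {set T})%type.
Local Notation e := (lrel lab).

Let eC : symmetric e. Proof. by move=> u v; rewrite /lrel ladjC. Qed.

Definition stable_pair (k l : nat) : pred pair := fun p =>
  [&& stable e p.1, stable e p.2, #|p.1| == k & #|p.2| == l].

Definition has_claw (p : pair) := [exists x, @claws T lab N p x].

Lemma has_clawPn p t s m n o : ~~ has_claw p -> valid N m n ->
  ~~ claw_at lab t s m n (orient o p).1 (orient o p).2.
Proof.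
move=> nc vmn; apply: contra nc => cl; have [m1 mn od nN] := and4P vmn.
have nlt : (n < N.+1)%N by clear -nN; lia.
have mlt : (m < N.+1)%N by clear -mn nN; lia.
apply/existsP; exists (Ordinal mlt, Ordinal nlt, o); rewrite /claws /= vmn /=.
by apply/claw_ofP; exists t, s.
Qed.

Lemma edges_nbrs (X S : {set T}) : edges e X S = (\sum_(v in X) #|nbrs lab v S|)%N.
Proof.
apply: eq_bigr => v _; rewrite -sum1_card big_mkcond [RHS]big_mkcond /=.
by apply: eq_bigr => u _; rewrite inE; case: (u \in S) => //; case: (lrel lab v u).
Qed.

Section Swapped.
Variables (k l : nat) (p : pair).
Hypotheses (pkl : stable_pair k l p) (nc : ~~ has_claw p) (odp : odd (edges e p.1 p.2)).

Let st1 : stable e p.1. Proof. by case/and4P: pkl. Qed.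
Let st2 : stable e p.2. Proof. by case/and4P: pkl. Qed.

Lemma stable_pair_swap : stable_pair k l (swap e p).
Proof.
have [_ _ /eqP pk /eqP pl] := and4P pkl.
have [s1 s2] := swap_stable eC st1 st2 odp.
have [K Kc|K Kc|c1 c2] := swap_card eC st1 st2 _ _ odp.
- by rewrite edges_nbrs; apply: (degree_sum lab_inj lab_range st1 st2 Kc) => t s m n;
    apply: (has_clawPn _ _ true).
- rewrite edges_nbrs; apply: (degree_sum lab_inj lab_range st2 st1) => [|t s m n].
    by move=> u v; rewrite setUC; apply: Kc.
  exact: (has_clawPn _ _ false).
by rewrite /stable_pair s1 s2 c1 c2 pk pl !eqxx.
Qed.

Lemma odd_edges_swap : odd (edges e (swap e p).1 (swap e p).2).
Proof.
have [s1 s2] := swap_stable eC st1 st2 odp.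
have := sdiff_edges_all eC s1 s2; rewrite sdiff_swap_on (sdiff_edges_all eC st1 st2).
by move/double_inj <-.
Qed.

(** Swapping back would carry an isolated tree to one in [p], possibly with the opposite
    orientation. *)
Lemma has_claw_swap : ~~ has_claw (swap e p).
Proof.
apply/negP => /existsP[[[m n] o]]; rewrite /claws /= => /andP[vmn /claw_ofP[t [s cl]]].
set K := odd_comp e (sdiff p).
have Kc u v : u \in K -> v \in (orient o (swap e p)).1 :|: (orient o (swap e p)).2 ->
    lrel lab u v -> v \in K.
  move=> uK vU; apply: (odd_comp_closed eC st1 st2 odp uK) => //; move: vU.
  rewrite /swap -/K /swap_on.
  by case: (o); rewrite !inE; case: (v \in K); case: (v \in p.1); case: (v \in p.2).
have := claw_swap lab_inj lab_range lab_surj vmn Kc cl.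
have -> : swap_on K ((orient o (swap e p)).1, (orient o (swap e p)).2) = orient o p.
  have Ep : swap_on K (swap e p) = p by rewrite /swap -/K swap_onK.
  case: (o); first by rewrite -surjective_pairing.
  by transitivity ((swap_on K (swap e p)).2, (swap_on K (swap e p)).1); rewrite // Ep.
case/orP; first by apply/negP/has_clawPn.
have -> : (orient o p).1 = (orient (~~ o) p).2 by case: (o).
have -> : (orient o p).2 = (orient (~~ o) p).1 by case: (o).
by apply/negP/has_clawPn.
Qed.

End Swapped.

Local Notation mon := (mon g).

Lemma sum_odd_noclaw k l :
  \sum_(p | stable_pair k l p && ~~ has_claw p && odd (edges e p.1 p.2)) mon p.1 * mon p.2 = 0.
Proof.
apply: oppr_fix; rewrite {1}(reindex_inj (inv_inj (swapK e))) -sumrN.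
have inv p : stable_pair k l p && ~~ has_claw p && odd (edges e p.1 p.2) ->
    stable_pair k l (swap e p) && ~~ has_claw (swap e p) &&
    odd (edges e (swap e p).1 (swap e p).2).
  move=> /andP[/andP[pkl nc] od].
  by rewrite stable_pair_swap // (has_claw_swap pkl) // (odd_edges_swap pkl).
apply: eq_big => [p|p /inv].
  by apply/idP/idP => /inv //; rewrite swapK.
rewrite swapK => /andP[/andP[/and4P[s1 s2 _ _] _] od].
exact: swap_mon.
Qed.

(** Pairs with an even number of edges commute; for the odd ones the commutator is twice the
    product, and these products cancel by the swap. *)
Lemma sum_noclaw k l :
  \sum_(p | stable_pair k l p && ~~ has_claw p) (mon p.1 * mon p.2 - mon p.2 * mon p.1) = 0.
Proof.
rewrite (bigID (fun p => odd (edges e p.1 p.2))) /= [X in _ + X]big1 => [|p /andP[_ ev]].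
  rewrite addr0 (eq_bigr (fun p => mon p.1 * mon p.2 + mon p.1 * mon p.2)).
    by rewrite big_split /= !sum_odd_noclaw addr0.
  move=> p /andP[_ od]; rewrite [mon p.2 * _](monC gC) (edgesC eC) -signr_odd od.
  by rewrite mulN1r opprK.
rewrite [mon p.2 * _](monC gC) (edgesC eC) -signr_odd (negbTE ev) mul1r.
by rewrite subrr.
Qed.

(** The two values of [o] give the two orders of the product: both halves of the commutator vanish
    separately. *)
Lemma sum_claw k l (o : bool) :
  \sum_(p | stable_pair k l p && has_claw p) mon (orient o p).1 * mon (orient o p).2 = 0.
Proof.
rewrite (reindex_inj (inv_inj (orientK (T := T) o))) /=.
have hc p : has_claw (orient o p) = has_claw p.
  apply/existsP/existsP => -[[[m n] o'] H]; exists (m, n, if o then o' else ~~ o');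
  by move: H; rewrite /claws; case: (o) => //=; case: o'; case: p.
rewrite (eq_bigl (fun p => stable_pair k l (orient o p) && has_claw p)); last first.
  by move=> p; rewrite hc.
rewrite (eq_bigr (fun p => mon p.1 * mon p.2)) => [|p _]; last by rewrite orientK.
have rel := claw_rel lab_inj lab_surj gC bracket_rel.
have rel_rev := claw_rel_rev lab_inj lab_surj gC bracket_rel.
apply: (sum_claws lab_surj gC rel rel_rev (Q := fun p => stable_pair k l (orient o p))).
  by move=> p /and4P[]; case: (o).
move=> o' t0 s0 t s m n q vmn cl.
have [c1 c2] := exchange_card lab_inj lab_surj t s vmn cl.
have st := @exchange_stable _ lab N t s m n q vmn.
have oo r : orient o (orient o' r) = orient (o == o') r.
  by case: (o); case: (o') => //; case: r.
rewrite !oo /stable_pair; case: (o == o') => /= /and4P[s1 s2 k1 k2].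
  by have [-> ->] := st s1 s2; rewrite c1 c2 k1.
by have [-> ->] := st s2 s1; rewrite c1 c2 k1.
Qed.

Lemma stable_sums_commute k l :
  (\sum_(S | stable e S && (#|S| == k)) mon S) * (\sum_(S | stable e S && (#|S| == l)) mon S) =
  (\sum_(S | stable e S && (#|S| == l)) mon S) * (\sum_(S | stable e S && (#|S| == k)) mon S).
Proof.
apply/eqP; rewrite -subr_eq0 !big_distrlr /= [X in _ - X]exchange_big !pair_big /= -sumrB.
rewrite (eq_bigl (stable_pair k l)); last first.
  by move=> p; rewrite /stable_pair; case: (stable e p.1); case: (stable e p.2); rewrite /= ?andbF.
rewrite (bigID has_claw) /= sum_noclaw addr0 sumrB.
by rewrite (sum_claw k l true) (sum_claw k l false) subrr.
Qed.

End Commutation.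

(** * The labels of the frustration graph *)

Definition vertex_label (M : nat) (v : vert M) : label :=
  match v with
  | inl i => if odd i then (KE, i.+1./2) else (KO, i./2.+1)
  | inr m => (KB, val m)
  end.

Lemma vertex_label_inj M : injective (@vertex_label M).
Proof.
move=> [i|m] [j|m'] //=; try by case: ifP.
- by case: ifP => oi; case: ifP => oj [] // E; congr inl; apply: ord_inj; clear -oi oj E; lia.
- by move=> [E]; congr inr; apply: val_inj.
Qed.

Lemma vertex_label_range M (v : vert M) : in_range M./2 (vertex_label v).
Proof.
case: v => [i|m] /=; last by have := ltn_ord m.
by have := ltn_ord i; case: ifP => /=; clear; lia.
Qed.

Lemma vertex_label_surj M a k : (0 < k)%N -> (k <= M./2)%N ->
  exists2 v : vert M, vertex_label v = (a, k) &
  forall (A : algType 'CC) (h hb : nat -> A), gen h hb v =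
    match a with KO => h (2 * k - 1)%N | KE => h (2 * k)%N | KB => hb (2 * k + 1)%N end.
Proof.
move=> k0 kM; case: a => [[]|].
- have lt : ((2 * k - 2) < M)%N by lia.
  exists (inl (Ordinal lt)) => [|A h hb] /=; last by congr h; lia.
  by rewrite ifN; [congr (_, _); lia | lia].
- have lt : (k < M./2.+1)%N by lia.
  by exists (inr (Ordinal lt)) => [|A h hb] //=; congr hb; lia.
- have lt : ((2 * k - 1) < M)%N by lia.
  exists (inl (Ordinal lt)) => [|A h hb] /=; last by congr h; lia.
  by rewrite ifT; [congr (_, _); lia | lia].
Qed.

Lemma adj_label M : @adj M =2 lrel (@vertex_label M).
Proof.
move=> [i|m] [j|m']; rewrite /lrel /= /dist12 /bar_h_adj.
- by case: ifP; case: ifP => /=; clear; lia.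
- by case: ifP => /=; clear; lia.
- by case: ifP => /=; clear; lia.
- by clear; lia.
Qed.

Theorem theorem2 (A : algType 'CC) (M : nat) (h hb : nat -> A) (b bb : nat -> 'CC)
  (HM : (1 <= M)%N)
  (Hsq : forall j : nat, (1 <= j <= M)%N -> h j ^+ 2 = (b j ^+ 2) *: 1)
  (Hsqb : forall m : nat, (m <= M./2)%N ->
     hb m.*2.+1 ^+ 2 = (bb m.*2.+1 ^+ 2) *: 1)
  (Hanti : forall u v : vert M, adj u v ->
     gen h hb u * gen h hb v = - (gen h hb v * gen h hb u))
  (Hcomm : forall u v : vert M, u != v -> ~~ adj u v ->
     gen h hb u * gen h hb v = gen h hb v * gen h hb u)
  (HAC : forall m : nat, (2 <= m)%N -> (m <= M./2 - 2)%N ->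
     Aop M h hb m * Cop M h hb m.+1 = Cop M h hb m * Aop M h hb m.+2) :
  forall k l : nat, charge M h hb k * charge M h hb l = charge M h hb l * charge M h hb k.
Proof.
have inj := @vertex_label_inj M; have rg := @vertex_label_range M.
have surj a k : (0 < k)%N -> (k <= M./2)%N -> exists v : vert M, vertex_label v = (a, k).
  by move=> k0 kM; have [v lv _] := vertex_label_surj a k0 kM; exists v.
have gC (u v : vert M) : gen h hb u * gen h hb v =
    (-1) ^+ lrel (@vertex_label M) u v * (gen h hb v * gen h hb u).
  rewrite -adj_label; case uv: (adj u v); first by rewrite mulN1r Hanti.
  by have [->|ne] := eqVneq u v; rewrite mul1r //; apply: Hcomm; rewrite ?uv.
have lgE a k : (0 < k)%N -> (k <= M./2)%N -> lgen (@vertex_label M) (gen h hb) (a, k) =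
    match a with KO => h (2 * k - 1)%N | KE => h (2 * k)%N | KB => hb (2 * k + 1)%N end.
  by move=> k0 kM; have [v <- vE] := vertex_label_surj a k0 kM; rewrite lgenE // vE.
have rel k : (1 < k)%N -> (k.+2 <= M./2)%N ->
    bracket (@vertex_label M) (gen h hb) k *
      (lgen (@vertex_label M) (gen h hb) (KO, k) * lgen (@vertex_label M) (gen h hb) (KB, k.+2)) =
    lgen (@vertex_label M) (gen h hb) (KO, k.-1) * lgen (@vertex_label M) (gen h hb) (KB, k.+1) *
      bracket (@vertex_label M) (gen h hb) k.+2.
  move=> k1 kM; have := HAC k k1 ltac:(lia).
  rewrite /Aop /Cop /bracket !lgE; try lia.
  have hzE j : (0 < j)%N -> (j <= M)%N -> hz M h j = h j by move=> j0 jM; rewrite /hz j0 jM.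
  have hbzE j : (j <= M./2)%N -> hbz M hb (2 * j + 1) = hb (2 * j + 1)%N.
    by move=> jM; rewrite /hbz ifT //; lia.
  (* As [1 < k], no subtraction truncates, and every index that occurs lies in the range where [hz]
     and [hbz] are the generators. *)
  have [e1 e2 e3 e4] : [/\ (2 * k + 3 = 2 * k.+1 + 1)%N, (2 * k.+1 + 3 = 2 * k.+2 + 1)%N,
      (2 * k - 3 = 2 * k.-1 - 1)%N & (2 * k - 2 = 2 * k.-1)%N] by split; clear -k1; lia.
  have [e5 e6 e7] : [/\ (2 * k.+1 - 3 = 2 * k - 1)%N, (2 * k.+2 - 3 = 2 * k.+1 - 1)%N &
      (2 * k.+2 - 2 = 2 * k.+1)%N] by split; clear -k1; lia.
  rewrite e1 e2 e3 e4 e5 e6 e7.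
  by rewrite !hbzE 1?hzE 1?hzE 1?hzE 1?hzE 1?hzE 1?hzE 1?hzE 1?hzE //; clear -k1 kM; lia.
have fix0 (x : A) : x = - x -> x = 0.
  move=> /eqP; rewrite -addr_eq0 -mulr2n -scaler_nat scaler_eq0 pnatr_eq0 /=.
  by move/eqP.
have chE k : charge M h hb k =
    \sum_(S | stable (lrel (@vertex_label M)) S && (#|S| == k)) mon (gen h hb) S.
  apply: eq_bigl => S; congr (_ && _); rewrite /independent /stable.
  by under eq_forallb => u do under eq_forallb => v do rewrite adj_label.
move=> k l; rewrite !chE; exact: (stable_sums_commute inj rg surj gC rel fix0).
Qed.
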